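(* Let $(X,d,\mu)$ be a compact metric measure space with $\mu$ a doubling Radon measure, let $p\ge 1$, $\alpha>0$, and let $\{\rho_n, n\in\mathbb N\}$ be a local transition kernel on $X$. Assume that the generalized $p$-Poincaré inequality (with parameter $\alpha$) and the controlled cutoff condition (with parameter $\alpha$) hold for $\{\rho_n\}$. Then the property $\mathcal{P}(p,\alpha)$ holds. Moreover, in that case, there exist constants $C_1,C_2>0$ such that for every $f\in KS^{\alpha,p}(X)$, $$C_1\,\mathrm{Var}_p(f)^p\le \inf_{(f_m)}\ \liminf_{m\to+\infty}\ \liminf_{n\to+\infty}\ \nu_{n,p}(f_m,X)\le C_2\,\mathrm{Var}_p(f)^p,$$ where the infimum is taken over the sequences of functions $f_m\in\mathcal{F}_p$ such that $f_m\to f$ in $L^p(X,\mu)$.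
   Context: Setting: $(X,d)$ is a compact metric space with more than one point; $\mu$ is a Radon measure on $X$ which is positive and doubling: there is $C>0$ with $0<\mu(B(x,2r))\le C\mu(B(x,r))<+\infty$ for all $x\in X$, $r>0$, where $B(x,r)=\{y: d(x,y)<r\}$. $C(X)$ is the space of continuous functions on $X$, $\mathcal B(X)$ the Borel sets, $d(A,B)=\inf\{d(x,y):x\in A,y\in B\}$. For $p\ge1$, $\alpha\ge0$, $r>0$, $f\in L^p(X,\mu)$ put $$E_{p,\alpha}(f,r)=\int_X\frac{1}{\mu(B(x,r))}\int_{B(x,r)}\frac{|f(y)-f(x)|^p}{r^{p\alpha}}\,d\mu(y)\,d\mu(x).$$ $\mathcal B^{\alpha,p}(X)=\{f\in L^p(X,\mu):\sup_{r>0}E_{p,\alpha}(f,r)<+\infty\}$ and $KS^{\alpha,p}(X)=\{f\in L^p(X,\mu):\limsup_{r\to0}E_{p,\alpha}(f,r)<+\infty\}$. ''Constant'' means constant $\mu$-a.e. The $L^p$ critical Besov exponent is $\alpha_p=\sup\{\alpha\ge0:\mathcal B^{\alpha,p}(X)\text{ contains non-constant functions}\}$. Property $\mathcal P(p,\alpha)$: $KS^{\alpha,p}(X)$ contains non-constant functions and there is a constant $C\ge1$ such that for every $f\in KS^{\alpha,p}(X)$, $\sup_{r>0}E_{p,\alpha}(f,r)\le C\liminf_{r\to0}E_{p,\alpha}(f,r)$. (If $\mathcal P(p,\alpha)$ holds, then $\alpha=\alpha_p$.) $\mathrm{Var}_p(f)=\liminf_{r\to0}E_{p,\alpha_p}(f,r)^{1/p}$.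 A local transition kernel $\{\rho_n,n\in\mathbb N\}$ on $X$ is a sequence of Radon measures $\rho_n:\mathcal B(X)\otimes\mathcal B(X)\to\mathbb R_{\ge0}$ (i.e. on $X\times X$) such that for any closed sets $A,B\subset X$ with $d(A,B)>0$, $\lim_{n\to+\infty}\int_A\int_B d\rho_n(x,y)=0$. For $f\in C(X)$ and $A\in\mathcal B(X)$: $\nu_{n,p}(f,A)=\int_A\int_X|f(x)-f(y)|^p\,d\rho_n(x,y)$, and $\mathcal F_p=\{f\in C(X):\sup_n\nu_{n,p}(f,X)<+\infty\}$. Generalized $p$-Poincaré inequality: there exist $C>0$ and $\lambda\ge1$ such that for every $f\in\mathcal F_p$, $x\in X$, $r>0$, $$\int_{B(x,r)}|f(y)-f_{B(x,r)}|^p\,d\mu(y)\le C r^{p\alpha}\liminf_{n\to+\infty}\nu_{n,p}(f,B(x,\lambda r)),$$ where $f_{B(x,r)}=\frac1{\mu(B(x,r))}\int_{B(x,r)}f\,d\mu$. Controlled cutoff condition: there is a constant $C>0$ such that for every $\varepsilon>0$ there exists a covering $\{B_i^\varepsilon=B(x_i,\varepsilon)\}_i$ of $X$ such that the family $\{B_i^{5\varepsilon}=B(x_i,5\varepsilon)\}_i$ has the bounded overlap property uniformly in $\varepsilon$ (there is a constant $N$ independent of $\varepsilon$ with $\sum_i 1_{B_i^{5\varepsilon}}\le N$ on $X$), and an associated family of functions $\varphi_i^\varepsilon$ such that: $\varphi_i^\varepsilon\in\mathcal F_p$; $0\le\varphi_i^\varepsilon\le1$ on $X$; $\sum_i\varphi_i^\varepsilon=1$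 on $X$; $\varphi_i^\varepsilon=0$ in $X\setminus B_i^{2\varepsilon}$, where $B_i^{2\varepsilon}=B(x_i,2\varepsilon)$; and $\limsup_{n\to+\infty}\nu_{n,p}(\varphi_i^\varepsilon,X)\le C\,\mu(B_i^\varepsilon)/\varepsilon^{\alpha p}$. *)

(* Defs.v *)
From HB Require Import structures.
From mathcomp Require Import all_boot all_order all_algebra.
From mathcomp Require Import all_classical all_reals all_analysis.

Set Implicit Arguments.
Unset Strict Implicit.
Unset Printing Implicit Defensive.

Import Order.TTheory GRing.Theory Num.Theory.
Import numFieldNormedType.Exports.

Local Open Scope classical_set_scope.
Local Open Scope ring_scope.

HB.mixin Record isBorel (d : measure_display) (R : numDomainType) (T : Type)
    of Metric R T & Measurable d T := {
  measurable_borel : @measurable d T = <<s [set U : set T | open U] >>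
}.

#[short(type="borelMetricType")]
HB.structure Definition BorelMetric (d : measure_display) (R : numDomainType) :=
  { T of Metric R T & Measurable d T & isBorel d R T }.

(* The Borel sets are passed as [M] because the product type [X * X] carries a
   topology and a sigma-algebra but no joint structure.  In Hausdorff spaces
   compact sets are closed, hence Borel. *)
Definition radon (T : topologicalType) (R : realType) (m : set T -> \bar R)
    (M : set (set T)) : Prop :=
  (forall K, compact K -> (m K < +oo)%E) /\
  (forall A, M A ->
     m A = ereal_sup [set m K | K in [set K | compact K /\ K `<=` A]]).

Section MetricMeasure.
Context (d : measure_display) (R : realType) (X : borelMetricType d R).
Variable mu : {measure set X -> \bar R}.
Implicit Types (p a r : R) (f : X -> R).

Local Open Scope ereal_scope.

Definition doubling : Prop :=
  exists2 C : R, (0 < C)%R & forall (x : X) r, (0 < r)%R ->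
    [/\ 0 < mu (ball x (2 * r)%R),
        mu (ball x (2 * r)%R) <= C%:E * mu (ball x r) &
        C%:E * mu (ball x r) < +oo].

Definition set_dist (A B : set X) : \bar R :=
  ereal_inf [set (mdist x y)%:E | x in A & y in B].

(* Elements of L^p are represented by measurable functions rather than classes;
   [energy], [nonconstant] and [Lnorm] do not see null sets. *)
Definition energy p a f r : \bar R :=
  \int[mu]_x (((fine (mu (ball x r)))^-1)%:E *
    \int[mu]_(y in ball x r) (`|f y - f x| `^ p / r `^ (p * a))%:E).

Definition sup_energy p a f : \bar R :=
  ereal_sup [set energy p a f r | r in [set r | (0 < r)%R]].

Definition besov p a : set (X -> R) :=
  [set f | f \in Lfun mu p%:E /\ sup_energy p a f < +oo].

Definition korevaar_schoen p a : set (X -> R) :=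
  [set f | f \in Lfun mu p%:E /\ limf_esup (energy p a f) 0^'+ < +oo].

Definition nonconstant f : Prop :=
  ~ exists c : R, {ae mu, forall x, f x = c}.

(* Possibly [+oo], e.g. when [X] has two components at positive distance. *)
Definition critical_exponent p : \bar R :=
  ereal_sup [set a%:E | a in [set a : R | (0 <= a)%R /\
                                exists2 f, besov p a f & nonconstant f]].

Definition property_P p a : Prop :=
  (exists2 f, korevaar_schoen p a f & nonconstant f) /\
  exists2 C : R, (1 <= C)%R & forall f, korevaar_schoen p a f ->
    sup_energy p a f <= C%:E * limf_einf (energy p a f) 0^'+.

(* [fine] is harmless whenever [property_P p a] holds, since then
   [critical_exponent p = a%:E]. *)
Definition Var p f : \bar R :=
  limf_einf (fun r => energy p (fine (critical_exponent p)) f r `^ p^-1) 0^'+.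

Definition average f (B : set X) : R :=
  ((fine (mu B))^-1 * \int[mu]_(y in B) f y)%R.

Definition cvg_Lp p (f_ : nat -> X -> R) f : Prop :=
  Lnorm mu p%:E (EFin \o (f_ m \- f)%R) @[m --> \oo] --> 0.

Section Kernel.
Variable rho : nat -> {finite_measure set (X * X)%type -> \bar R}.

Definition local_kernel : Prop :=
  (forall n, radon (rho n) measurable) /\
  (forall A B : set X, closed A -> closed B -> 0 < set_dist A B ->
     rho n (A `*` B) @[n --> \oo] --> 0).

Definition nu p n f (A : set X) : \bar R :=
  \int[rho n]_(z in A `*` [set: X]) (`|f z.1 - f z.2| `^ p)%:E.

Definition Fp p : set (X -> R) :=
  [set f | continuous f /\ ereal_sup (range (fun n => nu p n f [set: X])) < +oo].

Definition poincare p a : Prop :=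
  exists C lam : R, [/\ (0 < C)%R, (1 <= lam)%R &
    forall f (x : X) r, Fp p f -> (0 < r)%R ->
      \int[mu]_(y in ball x r) (`|f y - average f (ball x r)| `^ p)%:E <=
      (C * r `^ (p * a))%:E *
        limn_einf (fun n => nu p n f (ball x (lam * r)%R))].

(* The index set [I] is arbitrary; [\esum] is the unconditional sum of
   nonnegative terms.  [C] and [N] do not depend on [e]. *)
Definition controlled_cutoff p a : Prop :=
  exists (C : R) (N : nat), (0 < C)%R /\ forall e : R, (0 < e)%R ->
    exists (I : choiceType) (c : I -> X) (phi : I -> X -> R),
    [/\ \bigcup_i ball (c i) e = [set: X],
        forall x, \esum_(i in [set: I]) (\1_(ball (c i) (5 * e)%R) x : R)%:E
                  <= (N%:R : R)%:E,
        forall i, [/\ Fp p (phi i),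
          forall x, (0 <= phi i x <= 1)%R,
          forall x, ~ ball (c i) (2 * e)%R x -> phi i x = 0%R &
          limn_esup (fun n => nu p n (phi i) [set: X]) <=
            (C / e `^ (a * p))%:E * mu (ball (c i) e)] &
        forall x, \esum_(i in [set: I]) (phi i x)%:E = 1].

Definition relaxed_energy p f : \bar R :=
  ereal_inf [set limn_einf (fun m => limn_einf (fun n => nu p n (f_ m) [set: X]))
            | f_ in [set f_ : nat -> X -> R |
                      (forall m, Fp p (f_ m)) /\ cvg_Lp p f_ f]].

End Kernel.
End MetricMeasure.

(* Main.v *)
Require Import Defs.
From HB Require Import structures.
From mathcomp Require Import all_boot all_order all_algebra.
From mathcomp Require Import finmap.
From mathcomp Require Import all_classical all_reals all_analysis.
From mathcomp Require Import measurable_realfun ring lra.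

Set Implicit Arguments.
Unset Strict Implicit.
Unset Printing Implicit Defensive.

Import Order.TTheory GRing.Theory Num.Theory.
Import numFieldNormedType.Exports.

Local Open Scope classical_set_scope.
Local Open Scope ring_scope.

(** The energy of [f] at radius [r] is a mean oscillation of [f] over balls of
    radius [r], and it is compared with the discrete energies [nu] in both
    directions.

    A function [g] in [Fp] satisfies, at every radius,
    [energy g r <= K * liminf_n nu_n g]: a covering by balls of radius [r]
    bounds the energy by the deviations of [g] from its averages over the
    doubled balls, the Poincare inequality bounds each of these by the lower
    limit of [nu] on a larger ball, and these larger balls overlap boundedly
    because the measure is doubling ([integral_osc_le_liminf_nu]).

    Conversely, a function [f] in Lp is regularized at scale [e] into
    [g = \sum_i mean_i * phi_i], where [mean_i] is the average of [f] over the
    [i]-th ball of the covering and [phi_i] is the cutoff function.  As the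
    cutoff functions sum to [1], the difference [g x - g y] of two points that
    are close to the [j]-th ball is a combination of [mean_i - mean_j] over the
    boundedly many balls near the [j]-th; pairs of distant points carry no mass
    in the limit, because the kernel is local.  With the bound on the energies
    of the cutoff functions this yields [liminf_n nu_n g <= K * energy f (6 * e)]
    together with [\int |g - f|^p <= K * e^(p a) * energy f (6 * e)]
    ([regularization_exists]).

    The two bounds meet in the relaxed energy.  The first one passes to limits
    in Lp since the radius is fixed, and gives
    [energy f r <= K1 * relaxed_energy f] for every radius
    ([energy_le_relaxed]).  The second one, along scales at which the energy of
    [f] approaches its lower limit, gives
    [relaxed_energy f <= K2 * liminf_r energy f r]
    ([relaxed_le_liminf_energy]).  Chaining them bounds the supremum of the
    energy by its lower limit, and shows that the relaxed energy and the lower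
    limit are comparable.  A cutoff function at a scale that separates two
    points is continuous and not constant, hence nonconstant almost everywhere
    since balls have positive measure.

    It remains to recognize the lower limit as the variation, that is, to see
    that the critical exponent is [a] ([property_P_critical]).  If [b > a], the
    energy of exponent [a] is [r^(p (b - a))] times the one of exponent [b];
    for a function of Besov exponent [b] it tends to [0] with [r], hence
    vanishes at all radii, and the function is constant. *)

(** * Powers of sums *)

Section powR_sums.
Context (R : realType) (p : R).
Hypothesis p_gt0 : 0 < p.

Lemma powR_norm_sum_le (I : Type) (s : seq I) (P : pred I) (F : I -> R) (N : nat) :
  (count P s <= N)%N ->
  `|\sum_(i <- s | P i) F i| `^ p <=
  N%:R `^ p * \sum_(i <- s | P i) `|F i| `^ p.
Proof.
move=> sN; have p0 : p != 0 by rewrite gt_eqF.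
set S := \sum_(i <- s | P i) `|F i| `^ p.
have S0 : 0 <= S by apply: sumr_ge0 => i _; exact: powR_ge0.
have -> : S = (S `^ p^-1) `^ p by rewrite -powRrM mulVf// powRr1.
rewrite -powRM// ?powR_ge0//; apply: ge0_ler_powR;
  rewrite ?nnegrE ?mulr_ge0 ?powR_ge0 ?(ltW p_gt0)//.
apply: (le_trans (ler_norm_sum _ _ _)).
(* Each term is at most [S `^ p^-1]. *)
apply: (@le_trans _ _ (\sum_(i <- s | P i) S `^ p^-1)); last first.
  rewrite big_const_seq iter_addr_0 -[leLHS]mulr_natl ler_wpM2r ?powR_ge0//.
  by rewrite ler_nat.
rewrite /S; elim: s {sN S S0} => [|j s IH]; first by rewrite !big_nil.
rewrite !big_cons; case: ifPn => // Pj.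
set S := \sum_(i <- s | P i) `|F i| `^ p.
have S0 : 0 <= S by apply: sumr_ge0 => i _; exact: powR_ge0.
have V0 : 0 <= p^-1 by rewrite invr_ge0 ltW.
apply: lerD.
  apply: (@le_trans _ _ ((`|F j| `^ p) `^ p^-1)).
    by rewrite -powRrM mulfV// powRr1.
  apply: ge0_ler_powR; rewrite ?nnegrE ?addr_ge0 ?powR_ge0//.
  by rewrite lerDl.
apply: (le_trans IH); apply: ler_sum => i _.
by apply: ge0_ler_powR; rewrite ?nnegrE ?addr_ge0 ?powR_ge0// lerDr powR_ge0.
Qed.

Lemma powR_normD_le (x y : R) :
  `|x + y| `^ p <= 2 `^ p * (`|x| `^ p + `|y| `^ p).
Proof.
have := @powR_norm_sum_le bool [:: true;
  false] predT (fun b => if b then x else y) 2 isT.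
by rewrite !big_cons !big_nil !addr0.
Qed.

(** Bernoulli's inequality, as the tangent to [x `^ p] at [1]. *)
Lemma powR_ge_tangent (x : R) : 1 <= p -> 0 <= x -> p * x <= x `^ p + (p - 1).
Proof.
rewrite le_eqVlt => /predU1P[<-|p1] x0; first by rewrite powRr1// mul1r subrr addr0.
have pB : 0 < p - 1 by rewrite subr_gt0.
have q0 : 0 < p / (p - 1) by rewrite divr_gt0.
have := @conjugate_powR _ x 1 p (p / (p - 1)) x0 ler01 p_gt0 q0.
rewrite mulr1 powR1 => /(_ _)/wrap[].
  by field; rewrite gt_eqF// gt_eqF.
rewrite -(ler_pM2l p_gt0) => /le_trans; apply; rewrite le_eqVlt; apply/orP; left.
by apply/eqP; field; rewrite gt_eqF// gt_eqF.
Qed.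

End powR_sums.

(** * Lower limits along a filter *)

Lemma limn_einf_filter (R : realType) (u : nat -> \bar R) :
  limn_einf u = limf_einf u \oo.
Proof. by []. Qed.

Section liminf.
Context (T : choiceType) (Y : filteredType T) (R : realType).
Implicit Types (f g : Y -> \bar R) (F : set_system Y) (t : \bar R).
Local Open Scope ereal_scope.

Lemma limf_einf_gt f F t : Filter F ->
  t < limf_einf f F -> F [set x | t < f x].
Proof.
move=> FF; rewrite limf_einfE => /ereal_sup_gt[_ [V FV <-] tV].
apply: filterS FV => x Vx /=; apply: (lt_le_trans tV).
by apply: ereal_inf_lbound; exists x.
Qed.

Lemma limf_einf_lt f F t V : limf_einf f F < t -> F V ->
  exists2 x, V x & f x < t.
Proof.
rewrite limf_einfE => Lt FV.
have /ereal_inf_lt[_ [x Vx <-] fxt] : ereal_inf (f @` V) < t.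
  by apply: le_lt_trans Lt; apply: ereal_sup_ubound; exists V.
by exists x.
Qed.

Lemma limf_esup_lt f F t : Filter F ->
  limf_esup f F < t -> F [set x | f x < t].
Proof.
move=> FF; rewrite limf_esupE => /ereal_inf_lt[_ [V FV <-] tV].
apply: filterS FV => x Vx /=; apply: le_lt_trans tV.
by apply: ereal_sup_ubound; exists x.
Qed.

Lemma limf_einf_ge f F t : F [set x | t <= f x] -> t <= limf_einf f F.
Proof.
move=> Ft; rewrite limf_einfE.
apply: le_trans (ereal_sup_ubound _); last first.
  by exists [set x | t <= f x] => //; reflexivity.
by apply: le_ereal_inf_tmp => _ [x /= tx <-].
Qed.

Lemma limf_einf_le f g F : Filter F ->
  (\forall x \near F, f x <= g x) -> limf_einf f F <= limf_einf g F.
Proof.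
move=> FF fg; rewrite !limf_einfE; apply: ge_ereal_sup => _ [V FV <-].
apply: le_trans (ereal_sup_ubound _); last first.
  by exists (V `&` [set x | f x <= g x]); [exact: filterI|reflexivity].
apply: le_ereal_inf_tmp => _ [x [Vx /= fgx] <-]; apply: le_trans fgx.
by apply: ereal_inf_lbound; exists x.
Qed.

Lemma limf_einf_ub f F t : ProperFilter F ->
  (\forall x \near F, f x <= t) -> limf_einf f F <= t.
Proof.
move=> FF ft; rewrite limf_einfE; apply: ge_ereal_sup => _ [V FV <-].
have [x [Vx fxt]] := filter_ex (filterI FV ft); apply: le_trans fxt.
by apply: ereal_inf_lbound; exists x.
Qed.

Lemma limf_esup_ub f F t :
  (\forall x \near F, f x <= t) -> limf_esup f F <= t.
Proof.
move=> Ft; rewrite limf_esupE;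
  apply: (@le_trans _ _ (ereal_sup (f @` [set x | f x <= t]))).
  by apply: ereal_inf_lbound; exists [set x | f x <= t].
by apply: ge_ereal_sup => _ [x /= xt <-].
Qed.

Lemma limf_einf_sup_le f F : ProperFilter F -> limf_einf f F <= limf_esup f F.
Proof.
move=> FF; rewrite leNgt; apply/negP => /[dup] /limf_einf_gt H.
rewrite limf_einfE => /ereal_sup_gt[_ [V FV <-]].
rewrite limf_esupE => /ereal_inf_lt[_ [W FW <-]].
have [x [Vx Wx]] := filter_ex (filterI FV FW).
apply/negP; rewrite -leNgt; apply: (@le_trans _ _ (f x)).
  by apply: ereal_inf_lbound; exists x.
by apply: ereal_sup_ubound; exists x.
Qed.

Lemma limf_einf_ge0 f F : Filter F -> (forall x, 0 <= f x) -> 0 <= limf_einf f F.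
Proof. by move=> FF f0; apply: limf_einf_ge; apply: filterS filterT => x _;
  exact: f0. Qed.

(** Infima over two sets of the filter add up to a lower bound on their
    intersection; the subtractions are legitimate once the lower limit of the
    sum is finite, which makes all these infima finite. *)
Lemma limf_einfD_ge f g F : ProperFilter F ->
  (forall x, 0 <= f x) -> (forall x, 0 <= g x) ->
  limf_einf f F + limf_einf g F <= limf_einf (fun x => f x + g x) F.
Proof.
move=> FF f0 g0; set L := limf_einf (fun x => f x + g x) F.
have [->|Lfin] := eqVneq L +oo; first exact: leey.
have L0 : 0 <= L by apply: limf_einf_ge0 => x; rewrite adde_ge0.
have {}Lfin : L \is a fin_num by rewrite ge0_fin_numE// ltey.
have key V W : F V -> F W ->
    ereal_inf (f @` V) + ereal_inf (g @` W) <= L.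
  move=> FV FW; rewrite /L limf_einfE; apply: le_trans (ereal_sup_ubound _);
    last first.
    by exists (V `&` W); [exact: filterI|reflexivity].
  apply: le_ereal_inf_tmp => _ [x [Vx Wx] <-].
  by apply: leeD; apply: ereal_inf_lbound; exists x.
have inf0 (h : Y -> \bar R) V : (forall x, 0 <= h x) -> 0 <= ereal_inf (h @` V).
  by move=> h0; apply: le_ereal_inf_tmp => _ [x _ <-].
have fin (h : Y -> \bar R) V : (forall x, 0 <= h x) -> ereal_inf (h @` V) <= L ->
    ereal_inf (h @` V) \is a fin_num.
  move=> h0 hL; rewrite ge0_fin_numE ?inf0//.
  by apply: (le_lt_trans hL); rewrite -ge0_fin_numE.
have gV W : F W -> ereal_inf (g @` W) \is a fin_num.
  move=> FW; apply: fin => //; apply: le_trans (key W W FW FW).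
  by rewrite leeDr// inf0.
have fL W : F W -> limf_einf f F <= L - ereal_inf (g @` W).
  move=> FW; rewrite limf_einfE; apply: ge_ereal_sup => _ [V FV <-].
  by rewrite leeBrDr ?gV// key.
have ffin : limf_einf f F \is a fin_num.
  rewrite ge0_fin_numE; last exact: limf_einf_ge0.
  apply: (le_lt_trans (fL setT filterT)).
  have fB : L - ereal_inf (g @` setT) \is a fin_num.
    by rewrite fin_numB Lfin gV//; exact: filterT.
  by rewrite -(fineK fB) ltry.
rewrite addeC -leeBrDr// [X in X <= _]limf_einfE; apply: ge_ereal_sup => _ [W FW <-].
by rewrite leeBrDr// addeC -leeBrDr ?gV// fL.
Qed.

Lemma limf_einf_sum_ge (I : Type) (s : seq I) (f : I -> Y -> \bar R) F :
  ProperFilter F -> (forall i x, 0 <= f i x) ->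
  \sum_(i <- s) limf_einf (f i) F <= limf_einf (fun x => \sum_(i <- s) f i x) F.
Proof.
move=> FF f0; elim: s => [|i s IH].
  rewrite big_nil; apply: limf_einf_ge0 => x; by rewrite big_nil.
rewrite big_cons; apply: (le_trans (leeD2l _ IH)).
apply: (le_trans (limf_einfD_ge _ _ _)) => //; first by move=> x; exact: sume_ge0.
by apply: limf_einf_le; apply: nearW => x; rewrite big_cons.
Qed.

(** The inverse [k] carries a lower bound of [h \o f] on a set of the filter
    back to a lower bound of [f] on the same set. *)
Lemma limf_einf_comp_le f F (h k : \bar R -> \bar R) :
  (forall x y, 0 <= x -> x <= y -> h x <= h y) ->
  (forall x y, 0 <= x -> x <= y -> k x <= k y) ->
  (forall x, 0 <= x -> 0 <= h x) -> (forall x, 0 <= x -> 0 <= k x) ->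
  (forall x, 0 <= x -> k (h x) = x) -> (forall x, 0 <= x -> h (k x) = x) ->
  (forall x, 0 <= f x) ->
  limf_einf (h \o f) F <= h (limf_einf f F).
Proof.
move=> hm km h0 k0 hK kK f0; rewrite {1}limf_einfE.
apply: ge_ereal_sup => _ [V FV <-]; set b := ereal_inf _.
have b0 : 0 <= b by apply: le_ereal_inf_tmp => _ [x _ <-] /=; exact: h0.
rewrite -(kK b)//; apply: hm; first exact: k0.
rewrite limf_einfE; apply: le_trans (ereal_sup_ubound _); last by exists V;
  [exact: FV|reflexivity].
apply: le_ereal_inf_tmp => _ [x Vx <-]; rewrite -[leRHS]hK//; apply: km => //.
by apply: ereal_inf_lbound; exists x.
Qed.

Lemma limf_einf_poweR f F (q : R) : (0 < q)%R -> Filter F -> (forall x, 0 <= f x) ->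
  limf_einf (fun x => f x `^ q^-1) F `^ q = limf_einf f F.
Proof.
move=> q0 FF f0.
have mono (r : R) x y : (0 < r)%R -> 0 <= x -> x <= y -> x `^ r <= y `^ r.
  move=> r0 x0 xy; apply: gt0_ler_poweR (xy);
    rewrite ?ltW// in_itv/= ?x0 leey// andbT.
  exact: le_trans xy.
have i0 : (0 < q^-1)%R by rewrite invr_gt0.
have K1 x : 0 <= x -> (x `^ q) `^ q^-1 = x.
  by move=> x0; rewrite -poweRrM mulfV ?gt_eqF// poweRe1.
have K2 x : 0 <= x -> (x `^ q^-1) `^ q = x.
  by move=> x0; rewrite -poweRrM mulVf ?gt_eqF// poweRe1.
have P (r : R) x : 0 <= x -> 0 <= x `^ r by move=> _; exact: poweR_ge0.
apply/eqP; rewrite eq_le; apply/andP; split.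
  rewrite -[leRHS]K2; last exact: limf_einf_ge0.
  apply: (mono) => //; first by apply: limf_einf_ge0 => x; exact: poweR_ge0.
  have := @limf_einf_comp_le f F (poweR^~ (q^-1)%R) (poweR^~ q).
  move=> /(_ (fun x y => mono _ x y i0) (fun x y => mono q x y q0)).
  by move=> /(_ (P (q^-1)%R) (P q) K2 K1 f0).
have := @limf_einf_comp_le (fun x => f x `^ q^-1) F (poweR^~ q) (poweR^~ (q^-1)%R).
move=> /(_ (fun x y => mono q x y q0) (fun x y => mono _ x y i0) (P q) (P (q^-1)%R)
  K1 K2).
move=> /(_ (fun x => poweR_ge0 _ _)); apply: le_trans.
by apply: limf_einf_le; apply: nearW => x /=; rewrite K2.
Qed.

End liminf.

Section liminf_scale.
Context (T : choiceType) (Y : filteredType T) (R : realType).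
Local Open Scope ereal_scope.

Lemma limf_einfZ_le (f : Y -> \bar R) (F : set_system Y) (k : R) : (0 < k)%R ->
  (forall x, 0 <= f x) -> limf_einf (fun x => k%:E * f x) F <= k%:E * limf_einf f F.
Proof.
move=> k0 f0; have i0 : (0 < k^-1)%R by rewrite invr_gt0.
have mono (r : R) (x y : \bar R) : (0 < r)%R -> 0 <= x -> x <= y -> r%:E * x <=
  r%:E * y.
  by move=> r0 _; rewrite lee_pmul2l// lte_fin.
have P (r : R) (x : \bar R) : (0 < r)%R -> 0 <= x -> 0 <= r%:E * x.
  by move=> r0 x0; rewrite mule_ge0// lee_fin ltW.
apply: (@limf_einf_comp_le _ _ _ f F (fun x => k%:E * x) (fun x => k^-1%:E * x)) =>
  //.
- by move=> x y; exact: mono.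
- by move=> x y; exact: mono.
- by move=> x; exact: P.
- by move=> x; exact: P.
- by move=> x _; rewrite muleA -EFinM mulVf ?mul1e// gt_eqF.
- by move=> x _; rewrite muleA -EFinM mulfV ?mul1e// gt_eqF.
Qed.

End liminf_scale.

(** * Integrals of nonnegative functions *)

Section integral_monotone.
Context (d : measure_display) (T : measurableType d) (R : realType).
Variable mu : {measure set T -> \bar R}.
Implicit Types (f g : T -> \bar R) (D : set T).
Local Open Scope ereal_scope.

(** The integral of a nonnegative function is a supremum over the simple
    functions below it; this gives monotonicity for arbitrary functions. *)
Lemma ge0_integral_mono D f g : (forall x, D x -> 0 <= f x) ->
  (forall x, D x -> f x <= g x) ->
  \int[mu]_(x in D) f x <= \int[mu]_(x in D) g x.
Proof.
move=> f0 fg; rewrite !ge0_integralE//; last first.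
  by move=> x Dx; exact: le_trans (f0 x Dx) (fg x Dx).
apply: le_ereal_sup => _ [h /= hf <-]; exists h => // x.
apply: (le_trans (hf x)); rewrite /patch; case: ifPn => // /set_mem; exact: fg.
Qed.

Lemma ge0_integral_subset A B f : (forall x, 0 <= f x) -> A `<=` B ->
  \int[mu]_(x in A) f x <= \int[mu]_(x in B) f x.
Proof.
move=> f0 AB; rewrite integral_mkcond [leRHS]integral_mkcond.
apply: ge0_integral_mono => x _; rewrite /patch; first by case: ifP.
case: ifPn => [/set_mem/AB/mem_set ->//|_]; by case: ifP.
Qed.

Lemma sume_const_count (I : Type) (s : seq I) (P : pred I) (b : \bar R) :
  0 <= b -> \sum_(i <- s | P i) b = (count P s)%:R%:E * b.
Proof.
move=> b0; elim: s => [|i s IH]; first by rewrite big_nil mul0e.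
rewrite big_cons IH /=; case: ifP => _; last by rewrite add0n.
by rewrite natrD EFinD ge0_muleDl ?lee_fin// mul1e.
Qed.

Lemma sum_patch_count (I : Type) (s : seq I) (A : I -> set T) g x :
  0 <= g x ->
  \sum_(i <- s) (g \_ (A i)) x = (count (fun i => x \in A i) s)%:R%:E * g x.
Proof.
move=> g0; elim: s => [|i s IH]; first by rewrite big_nil mul0e.
rewrite big_cons IH /= patchE; case: ifP => _; last by rewrite add0e add0n.
by rewrite natrD EFinD ge0_muleDl ?lee_fin// mul1e.
Qed.

Lemma sum_integral_le_overlap (I : Type) (s : seq I) (A : I -> set T) g (N : nat) :
  (forall i, measurable (A i)) -> measurable_fun [set: T] g ->
  (forall x, 0 <= g x) ->
  (forall x, (count (fun i => x \in A i) s <= N)%N) ->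
  \sum_(i <- s) \int[mu]_(x in A i) g x <= N%:R%:E * \int[mu]_x g x.
Proof.
move=> mA mg g0 cN; under eq_bigr do rewrite integral_mkcond.
rewrite -ge0_integral_sum//; last 2 first.
- by move=> i; apply/(measurable_restrictT _ (mA i)); exact: measurable_funTS.
- by move=> i x _; rewrite /patch; case: ifP.
rewrite -ge0_integralZl//.
apply: ge0_integral_mono => x _.
  by apply: sume_ge0 => i _; rewrite /patch; case: ifP.
by rewrite sum_patch_count// lee_wpmul2r// lee_fin ler_nat.
Qed.

Lemma integral_le_sum_cover (I : eqType) (s : seq I) (A : I -> set T) g :
  (forall i, measurable (A i)) -> measurable_fun [set: T] g ->
  (forall x, 0 <= g x) ->
  (forall x, exists2 i, i \in s & A i x) ->
  \int[mu]_x g x <= \sum_(i <- s) \int[mu]_(x in A i) g x.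
Proof.
move=> mA mg g0 cov; under eq_bigr do rewrite integral_mkcond.
rewrite -ge0_integral_sum//; last 2 first.
- by move=> i; apply/(measurable_restrictT _ (mA i)); exact: measurable_funTS.
- by move=> i x _; rewrite /patch; case: ifP.
apply: ge0_integral_mono => x _ //; rewrite sum_patch_count//.
rewrite -[leLHS]mul1e lee_wpmul2r// lee_fin (ler_nat _ 1) -has_count.
by have [i si Ax] := cov x; apply/hasP; exists i => //; exact: mem_set.
Qed.

(** Bernoulli's inequality for [`|f - c| / t], with [t] the modulus on the
    left, integrates to Jensen's inequality for the power [p]. *)
Lemma powR_mean_le (p c : R) (B : set T) (f : T -> R) : (1 <= p)%R ->
  measurable B -> 0 < mu B -> mu B < +oo -> mu.-integrable B (EFin \o f) ->
  (`|(fine (mu B))^-1 * (\int[mu]_(y in B) f y)%R - c| `^ p)%:E * mu B <=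
  \int[mu]_(y in B) (`|f y - c| `^ p)%:E.
Proof.
move=> p1 mB B0 Boo fi; have p0 : (0 < p)%R by rewrite (lt_le_trans ltr01).
set t := `|_ - c|%R.
have mf : measurable_fun B f by apply/measurable_EFinP; case/integrableP: fi.
have mfp : measurable_fun B (fun y => (`|f y - c| `^ p)%R).
  apply: (measurableT_comp (measurable_powR p)).
  by apply: measurableT_comp => //; exact: measurable_funB.
have I0 : 0 <= \int[mu]_(y in B) (`|f y - c| `^ p)%:E.
  by apply: integral_ge0 => y _; rewrite lee_fin powR_ge0.
have [t0|tn0] := eqVneq t 0%R; first by rewrite t0 powR0 ?gt_eqF// mul0e.
have t0 : (0 < t)%R by rewrite lt_neqAle eq_sym tn0 normr_ge0.
set V := fine (mu B); have VE : mu B = V%:E by rewrite fineK// ge0_fin_numE.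
have V0 : (0 < V)%R by rewrite -lte_fin -VE.
have [->|Ifin] := eqVneq (\int[mu]_(y in B) (`|f y - c| `^ p)%:E) +oo.
  exact: leey.
have fip : mu.-integrable B (EFin \o (fun y => (`|f y - c| `^ p)%R)).
  apply/integrableP; split; first exact/measurable_EFinP.
  under eq_integral do rewrite /= ger0_norm ?powR_ge0//.
  by rewrite ltey.
have ic k : mu.-integrable B (EFin \o (cst k : T -> R)).
  apply/integrableP; split; first exact/measurable_EFinP.
  rewrite (_ : \int[mu]_(x in B) _ = \int[mu]_(x in B) cst (`|k|%:E) x)//.
  by rewrite integral_cst// VE -EFinM ltry.
have fic : mu.-integrable B (EFin \o (fun y => (f y - c)%R)).
  by have := integrableB mB fi (ic c); apply: eq_integrable.
have fin := integrable_norm fic.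
set J := (\int[mu]_(y in B) (`|f y - c| `^ p))%R.
have JE : \int[mu]_(y in B) (`|f y - c| `^ p)%:E = J%:E.
  by rewrite fineK// ge0_fin_numE// ltey.
set K := (\int[mu]_(y in B) `|f y - c|)%R.
have tK : (t * V <= K)%R.
  rewrite /t -/V -[X in (_ * X <= _)%R](gtr0_norm V0) -normrM mulrBl mulrAC mulVf
    ?gt_eqF// mul1r.
  rewrite -Rintegral_cst// -RintegralB//; last exact: ic.
  exact: (le_normr_Rintegral mB fic).
have pt y : (p * t `^ (p - 1) * `|f y - c| <= `|f y - c| `^ p + (p - 1) * t `^ p)%R.
  have := powR_ge_tangent p0 p1 (divr_ge0 (normr_ge0 (f y - c)%R) (ltW t0)).
  rewrite -(ler_pM2r (powR_gt0 p t0)) mulrDl -powRM ?divr_ge0 ?(ltW t0)//.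
  rewrite divfK ?gt_eqF//; apply: le_trans; rewrite le_eqVlt; apply/orP; left;
    apply/eqP.
  have -> : (t `^ p = t * t `^ (p - 1))%R.
    by rewrite -{2}(powRr1 (ltW t0)) -powRD ?gt_eqF ?implybT// addrC subrK.
  by field; rewrite gt_eqF.
have : (p * t `^ (p - 1) * K <= J + (p - 1) * t `^ p * V)%R.
  rewrite /K /J -RintegralZl// -Rintegral_cst// -RintegralD//; last exact: ic.
  apply: le_Rintegral => //.
  - have := integrableZl mB (p * t `^ (p - 1))%R fin.
    by apply: eq_integrable.
  - have := integrableD mB fip (ic ((p - 1) * t `^ p)%R).
    by apply: eq_integrable.
have : (p * t `^ (p - 1) * (t * V) <= p * t `^ (p - 1) * K)%R.
  by rewrite ler_wpM2l// mulr_ge0 ?powR_ge0 ?(ltW p0).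
have -> : (p * t `^ (p - 1) * (t * V) = p * (t `^ p * V))%R.
  have -> : (t `^ p = t * t `^ (p - 1))%R.
    by rewrite -{2}(powRr1 (ltW t0)) -powRD ?gt_eqF ?implybT// addrC subrK.
  by ring.
move=> /le_trans /[apply]; rewrite JE VE -EFinM lee_fin; lra.
Qed.

End integral_monotone.

(** * Borel sets of a compact metric space *)

Section metric_borel.
Context (d : measure_display) (R : realType) (X : borelMetricType d R).
Implicit Types (x y z : X) (r e : R) (f : X -> R).

Lemma mem_ball x r y : ball x r y = (mdist x y < r) :> Prop.
Proof. by rewrite ballEmdist. Qed.

Lemma in_ballE x r y : (y \in (ball x r : set X)) = (mdist x y < r).
Proof. by apply/idP/idP => [/set_mem|h]; [|apply/mem_set]; rewrite mem_ball. Qed.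

Lemma ball_subset x y r e : mdist x y + r <= e -> ball y r `<=` ball x e.
Proof.
move=> xyre z; rewrite !mem_ball => yz.
by apply: le_lt_trans (metric_triangle x y z) _; lra.
Qed.

Lemma open_metric_ball x r : open (ball x r).
Proof.
rewrite openE => y; rewrite mem_ball => xy; rewrite /interior.
apply/nbhs_ballP; exists (r - mdist x y) => /=; first by rewrite subr_gt0.
by apply: ball_subset; lra.
Qed.

Lemma measurable_open (U : set X) : open U -> measurable U.
Proof. by move=> oU; rewrite measurable_borel; exact: sub_gen_smallest. Qed.

Lemma measurable_metric_ball x r : measurable (ball x r).
Proof. exact/measurable_open/open_metric_ball. Qed.

Lemma continuous_measurable f : continuous f -> measurable_fun [set: X] f.
Proof.
move=> /continuousP cf.
apply: (measurability _ (RGenOpens.measurableE R)).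
move=> _ [_ [a [b ->] <-]]; rewrite setTI.
exact/measurable_open/cf/interval_open.
Qed.

Lemma finite_net : compact [set: X] -> forall e, 0 < e ->
  exists s : seq X, forall x, exists2 z, z \in s & mdist z x < e.
Proof.
move=> /compact_near_coveringP cX e e0.
(* The filter of the lists that contain a given list: the compactness
   principle then yields one list that works for all points. *)
pose F : set_system (seq X) := [set W : set (seq X) | exists s0 : seq X,
  forall s : seq X, {subset s0 <= s} -> W s].
have FF : Filter F.
  split => [|A B [s1 As1] [s2 Bs2]|A B AB [s0 As0]].
  - by exists [::].
  - exists (s1 ++ s2) => s sub; split; [apply: As1|apply: Bs2] => z zs.
      by apply: sub; rewrite mem_cat zs.
    by apply: sub; rewrite mem_cat zs orbT.
  - by exists s0 => s /As0/AB.
have [x _|s0 /(_ s0 (fun _ h => h)) s0P] :=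
  cX (seq X) F (fun s x => exists2 z, z \in s & mdist z x < e) FF.
  exists (ball x e, [set s : seq X | x \in s]).
    by split; [exact: nbhsx_ballx|exists [:: x] => s; apply; rewrite mem_head].
  by move=> [y s] /= [xy xs]; exists x => //; rewrite -mem_ball.
by exists s0 => x; exact: s0P.
Qed.

Lemma finite_diameter : compact [set: X] ->
  exists2 D : R, 0 < D & forall x y, mdist x y < D.
Proof.
move=> /finite_net/(_ 1 ltr01)[[|z0 s] sP].
  by exists 1 => // x; have [z] := sP x.
set D := \sum_(z <- z0 :: s) mdist z0 z.
have D0 : 0 <= D by apply: sumr_ge0 => z _; exact: mdist_ge0.
have zD x : mdist z0 x < D + 1.
  have [z zs zx] := sP x.
  have : mdist z0 z <= D.
    by rewrite /D (big_rem z zs)/= lerDl; apply: sumr_ge0 => ? _; exact: mdist_ge0.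
  by have := metric_triangle z0 z x; lra.
exists (2 * (D + 1)); first lra.
move=> x y; have := metric_triangle x z0 y; rewrite (metric_sym x z0).
by have := zD x; have := zD y; lra.
Qed.

(** Compactness provides, for every [n], a finite net of mesh [1 / n.+1];
    a pair at distance less than [r] lies in a rectangle of two balls, centred
    at a point of one of the nets, whose radii add up to [r]. *)
Lemma measurable_near_diagonal : compact [set: X] -> forall r,
  measurable [set z : X * X | mdist z.1 z.2 < r].
Proof.
move=> cX r.
have net n : {s : seq X | forall x, exists2 z, z \in s & mdist z x < n.+1%:R^-1}.
  by apply: cid; apply: finite_net => //; rewrite invr_gt0.
pose s n := projT1 (net n).
rewrite [X in measurable X](_ : _ = \bigcup_n \bigcup_(z in [set` s n])
    (ball z n.+1%:R^-1 `*` ball z (r - n.+1%:R^-1))); last first.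
  apply/seteqP; split => [[x y] /= xyr|[x y] [n _ [z /= zs [/=]]]].
  - have h0 : 0 < (r - mdist x y) / 2 by lra.
    have [n /= hn] : exists n, n.+1%:R^-1 < (r - mdist x y) / 2.
      by have [n _ /(_ n (leqnn n))] := near_infty_natSinv_lt (PosNum h0); exists n.
    have [z zs zx] := projT2 (net n) x.
    exists n => //; exists z => //=; split => /=; rewrite mem_ball//.
    have := metric_triangle z x y; move: zx hn; set t := _^-1 => zx hn; lra.
  - rewrite !mem_ball => zx zy.
    have := metric_triangle x z y; rewrite (metric_sym x z).
    by move: zx zy; set t := _^-1 => zx zy; lra.
apply: bigcup_measurable => n _; apply: fin_bigcup_measurable => [|z _].
  exact: finite_seq.
by apply: measurableX; exact: measurable_metric_ball.
Qed.

End metric_borel.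

(** * Mean oscillation over balls *)

Section finite_borel_measure.
Context (d : measure_display) (R : realType) (X : borelMetricType d R).
Context (mu : {measure set X -> \bar R}) (p : R).
Context (X_compact : compact [set: X]) (mu_finite : (mu [set: X] < +oo)%E).
Implicit Types (x y z : X) (r e : R) (f : X -> R).

Definition vol x r : R := fine (mu (ball x r)).

(** The factor [r `^ (p * a)] is left out, so that one function serves the
    energies of all exponents. *)
Definition osc f r x : \bar R :=
  ((vol x r)^-1%:E * \int[mu]_(y in ball x r) (`|f y - f x| `^ p)%:E)%E.

Lemma mu_fin_num A : measurable A -> mu A \is a fin_num.
Proof.
move=> mA; rewrite ge0_fin_numE//; apply: le_lt_trans mu_finite.
by apply: le_measure; rewrite ?inE//.
Qed.

Lemma volE x r : mu (ball x r) = (vol x r)%:E.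
Proof. by rewrite /vol fineK//; apply: mu_fin_num; exact: measurable_metric_ball.
  Qed.

Lemma vol_ge0 x r : 0 <= vol x r.
Proof. by rewrite fine_ge0. Qed.

Lemma vol_subset x y r e : mdist x y + r <= e -> vol y r <= vol x e.
Proof.
move=> /ball_subset xy; rewrite -lee_fin -!volE.
by apply: le_measure; rewrite ?inE//; exact: measurable_metric_ball.
Qed.

Lemma osc_ge0 f r x : (0 <= osc f r x)%E.
Proof.
apply: mule_ge0; first by rewrite lee_fin invr_ge0 vol_ge0.
by apply: integral_ge0 => y _; rewrite lee_fin powR_ge0.
Qed.

Lemma measurable_powR_norm D (c : R) f : measurable_fun D f ->
  measurable_fun D (fun y => (`|f y - c| `^ p)%:E).
Proof.
move=> mf; apply/measurable_EFinP.
apply: (measurableT_comp (measurable_powR p)).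
by apply: measurableT_comp => //; exact: measurable_funB.
Qed.

(** Tonelli's theorem is stated for measures bundled with their finiteness. *)
Lemma finite_measure_of :
  exists m : {finite_measure set X -> \bar R}, m = mu :> (set X -> \bar R).
Proof.
exists (mfrestr measurableT mu_finite); apply/funext => A.
by change (mu (A `&` setT) = mu A); rewrite setIT.
Qed.

Lemma measurable_vol r : measurable_fun [set: X] (vol^~ r).
Proof.
have [m mE] := finite_measure_of.
apply: (measurableT_comp (fine_measurable measurableT)).
have := measurable_fun_xsection m (measurable_near_diagonal X_compact r).
congr measurable_fun; apply/funext => x; transitivity (mu (xsection
  [set z : X * X | mdist z.1 z.2 < r] x)); first exact: (congr1 (@^~ _) mE).
congr (mu _).
apply/seteqP; split => y; rewrite mem_ball /xsection /=; first by move/set_mem.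
by move=> xy; exact: mem_set.
Qed.

Lemma measurable_osc f r : measurable_fun [set: X] f ->
  measurable_fun [set: X] (osc f r).
Proof.
move=> mf; have [m mE] := finite_measure_of.
apply: emeasurable_funM.
  apply/measurable_EFinP.
  rewrite (_ : (fun x => _) = (fun x => vol x r `^ (-1))); last first.
    by apply/funext => x; rewrite powR_inv1 ?vol_ge0.
  exact: (measurableT_comp (measurable_powR _) (measurable_vol r)).
pose A := [set z : X * X | mdist z.1 z.2 < r].
pose F := (fun z : X * X => (`|f z.2 - f z.1| `^ p)%:E) \_ A.
have mF : measurable_fun [set: X * X] F.
  apply/(measurable_restrictT _ (measurable_near_diagonal X_compact r)).
  apply: measurable_funTS; apply/measurable_EFinP.
  apply: (measurableT_comp (measurable_powR p)).
  apply: measurableT_comp => //; apply: measurable_funB.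
    exact: (measurableT_comp mf measurable_snd).
  exact: (measurableT_comp mf measurable_fst).
have F0 (z : X * X) : (0 <= F z)%E.
  by rewrite /F /patch; case: ifP => // _; rewrite lee_fin powR_ge0.
have := measurable_fun_fubini_tonelli_F (m2 := m) F mF F0.
congr measurable_fun; apply/funext => x; transitivity (\int[mu]_y F (x, y))%E.
  exact: (congr1 (fun m' => integral m' setT (fun y => F (x, y))) mE).
rewrite [RHS]integral_mkcond; apply: eq_integral => y _.
rewrite /F !patchE /=; congr (if _ then _ else _).
by rewrite in_ballE; apply/idP/idP => [/set_mem|h] //; exact/mem_set.
Qed.

Lemma energyE (a : R) f r : measurable_fun [set: X] f ->
  energy mu p a f r = (((r `^ (p * a))^-1)%:E * \int[mu]_x osc f r x)%E.
Proof.
move=> mf; rewrite -ge0_integralZl//; last first.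
- by rewrite lee_fin invr_ge0 powR_ge0.
- by move=> x _; exact: osc_ge0.
- exact: measurable_osc.
apply: eq_integral => x _; rewrite /osc muleCA; congr (_ * _)%E.
rewrite -ge0_integralZl.
- by apply: eq_integral => y _; rewrite -EFinM mulrC.
- exact: measurable_metric_ball.
- by apply: measurable_powR_norm; exact: measurable_funTS.
- by move=> y _; rewrite lee_fin powR_ge0.
- by rewrite lee_fin invr_ge0 powR_ge0.
Qed.

Lemma integral_oscE (a : R) f r : measurable_fun [set: X] f -> 0 < r ->
  (\int[mu]_x osc f r x = (r `^ (p * a))%:E * energy mu p a f r)%E.
Proof.
move=> mf r0; rewrite energyE// muleA -EFinM mulfV ?mul1e//.
by rewrite gt_eqF// powR_gt0.
Qed.

Lemma Lfun_measurable f : f \in Lfun mu p%:E -> measurable_fun [set: X] f.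
Proof. by rewrite inE => /andP[+ _]; rewrite inE. Qed.

Lemma Lfun_ball_integrable f x r : 1 <= p -> f \in Lfun mu p%:E ->
  mu.-integrable (ball x r) (EFin \o f).
Proof.
move=> p1 fL; apply: (@integrableS _ _ _ _ [set: X]) => //.
  exact: measurable_metric_ball.
apply/Lfun1_integrable; apply: Lfun_subset fL => //.
by apply: mu_fin_num; exact: measurableT.
Qed.

Lemma continuous_bounded f : continuous f -> exists2 M : R, 0 < M & forall x, `|f
  x| <= M.
Proof.
move=> cf; have /compact_bounded[M [_ MP]] : compact (range f).
  by apply: continuous_compact => //; exact: continuous_subspaceT.
exists (`|M| + 1) => [|x]; first by rewrite ltr_wpDl.
by apply: MP; [have := ler_norm M; lra|exists x].
Qed.

Lemma continuous_Lfun f : 0 < p -> continuous f -> f \in Lfun mu p%:E.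
Proof.
move=> p0 cf; have mf := continuous_measurable cf.
have [M M0 fM] := continuous_bounded cf.
rewrite inE; apply/andP; split; rewrite inE//=.
rewrite /finite_norm -(@poweRe1 _ (Lnorm _ _ _)) ?Lnorm_ge0//.
have pn0 : p != 0 by rewrite gt_eqF.
rewrite -(mulfV pn0) poweRrM; apply: poweR_lty.
rewrite poweR_Lnorm ?gt_eqF//.
apply: (@le_lt_trans _ _ (\int[mu]_x (cst (M `^ p)%:E) x)%E).
  apply: ge0_integral_mono => x _; first exact: poweR_ge0.
  rewrite /= lee_fin; apply: ge0_ler_powR; rewrite ?nnegrE ?(ltW p0) ?(ltW M0)//.
rewrite integral_cst//.
have := mu_fin_num measurableT => /fineK <-; by rewrite -EFinM ltry.
Qed.

End finite_borel_measure.

(** * Doubling *)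

Section doubling_measure.
Context (d : measure_display) (R : realType) (X : borelMetricType d R).
Context (mu : {measure set X -> \bar R}).
Context (mu_finite : (mu [set: X] < +oo)%E) (mu_doubling : doubling mu).
Implicit Types (x y z : X) (r e : R).

Local Notation vol := (vol mu).

Lemma vol_gt0 x r : 0 < r -> 0 < vol x r.
Proof.
move=> r0; case: mu_doubling => C C0 /(_ x (r / 2)) [|+ _ _]; first lra.
by rewrite (_ : 2 * (r / 2) = r) ?volE ?lte_fin//; field.
Qed.

Lemma doubling_iter : exists2 C : R, 0 < C &
  forall k x r, 0 < r -> vol x (2 ^+ k * r) <= C ^+ k * vol x r.
Proof.
case: mu_doubling => C C0 dC; exists C => // k x r r0.
elim: k => [|k IH]; first by rewrite !expr0 !mul1r.
have kr : 0 < 2 ^+ k * r by rewrite mulr_gt0// exprn_gt0.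
have [_ + _] := dC x _ kr; rewrite !volE// -EFinM lee_fin mulrA -exprS.
by move=> /le_trans; apply; rewrite exprS -mulrA ler_wpM2l// ltW.
Qed.

Lemma natr_le_exp2 n : n%:R <= 2 ^+ n :> R.
Proof. by rewrite -natrX ler_nat ltnW// ltn_expl. Qed.

Lemma doubling_ball (M M' : R) : exists2 K : R, 0 < K &
  forall x y r, 0 < r -> mdist x y < M * r -> vol y (M' * r) <= K * vol x r.
Proof.
case: doubling_iter => C C0 dC; pose k := Num.bound `|M + M'|.
exists (C ^+ k) => [|x y r r0 xy]; first by rewrite exprn_gt0.
apply: le_trans (dC k x r r0); apply: vol_subset => //.
have : (M + M') * r <= 2 ^+ k * r.
  rewrite ler_pM2r//; apply: le_trans (natr_le_exp2 k).
  by apply: le_trans (ler_norm _) _; apply/ltW/archi_boundP.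
lra.
Qed.

(** By doubling, the mass of a ball of radius [r] is at least a fixed fraction
    of the mass of a ball whose radius exceeds the diameter of the space. *)
Lemma vol_lower_bound : compact [set: X] -> forall r, 0 < r ->
  exists2 c : R, 0 < c & forall x, c <= vol x r.
Proof.
move=> cX r r0; have [D D0 XD] := finite_diameter cX.
have [[x0 _]|nX] := pselect (exists x : X, True); last first.
  by exists 1 => // x; case: nX; exists x.
have DT x : ball x D = [set: X].
  by apply/seteqP; split => // y _; rewrite mem_ball.
have [K K0 dK] := doubling_ball 1 (D / r).
exists (vol x0 D / K) => [|x]; first by rewrite divr_gt0// vol_gt0.
rewrite ler_pdivrMr// mulrC.
have -> : vol x0 D = vol x D by rewrite -[LHS]/(fine (mu _)) -[RHS]/(fine (mu _))
  !DT.
have := dK x x r r0; rewrite divfK ?gt_eqF// mdistxx mul1r; exact.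
Qed.

(** The balls of radius [5 * e] centred within [k * e] of [x] lie in the ball
    of radius [(k + 5) * e] around [x], have masses comparable to its mass, and
    cover no point more than [N] times: the total mass bounds their number. *)
Lemma overlap_enlarge (k : R) (N : nat) : 0 <= k -> exists N' : nat,
  forall e (I : Type) (s : seq I) (c : I -> X), 0 < e ->
  (forall x, (count (fun i => (mdist (c i) x < 5 * e)%R) s <= N)%N) ->
  forall x, (count (fun i => (mdist (c i) x < k * e)%R) s <= N')%N.
Proof.
move=> k0; have [K K0 dK] := doubling_ball k (k + 5).
exists (Num.bound `|N%:R * K|) => e I s c e0 sN x.
pose s' := [seq i <- s | (mdist (c i) x < k * e)%R].
pose B := ball x ((k + 5) * e); pose V := vol x ((k + 5) * e).
have V0 : 0 < V by rewrite vol_gt0// mulr_gt0// ltr_wpDl.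
have s'N y : (count (fun i => y \in (ball (c i) (5 * e) : set X)) s' <= N)%N.
  apply: leq_trans (sN y); rewrite count_filter; apply: sub_count => i /= /andP[+ _].
  by rewrite in_ballE.
have := @sum_integral_le_overlap _ _ _ mu _ s' (fun i => ball (c i) (5 * e))
  (EFin \o (\1_B : X -> R)) N (fun i => measurable_metric_ball _ _) _ _ s'N.
move=> /(_ _ _)/wrap[]; first by apply/measurable_EFinP; apply: measurable_indic;
  exact: measurable_metric_ball.
  by move=> y; rewrite lee_fin.
rewrite integral_indic ?setIT//; last exact: measurable_metric_ball.
rewrite (volE mu_finite) -EFinM -/V => H.
have : (\sum_(i <- s') (V / K)%:E <= (N%:R * V)%:E)%E.
  apply: le_trans H; rewrite /s' !big_filter.
  apply: lee_sum => i /= xk.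
  rewrite integral_indic; [|exact: measurable_metric_ball..].
  rewrite setIidr ?volE//; last first.
    by apply: ball_subset; rewrite metric_sym; lra.
  rewrite lee_fin ler_pdivrMr// mulrC.
  apply: le_trans (dK (c i) x e e0 xk) _; rewrite ler_wpM2l ?(ltW K0)//.
  by apply: vol_subset => //; rewrite mdistxx; lra.
rewrite sumEFin lee_fin big_const_seq count_predT iter_addr_0 -[leLHS]mulr_natl.
rewrite mulrA ler_pdivrMr// mulrAC ler_pM2r// size_filter -(ler_nat R) =>
  /le_trans; apply.
by apply: le_trans (ler_norm _) _; apply/ltW/archi_boundP.
Qed.

End doubling_measure.

(** * Finite partitions of unity *)

Section finite_partition.
Context (d : measure_display) (R : realType) (X : borelMetricType d R).
Context (X_compact : compact [set: X]).

(** Each point of the list [s] belongs to at most [N] of the sets, and every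
    set contains such a point. *)
Lemma esum_bound_finite (I : choiceType) (A : I -> set X) (N : nat) (s : seq X) :
  (forall i, exists2 z, z \in s & A i z) ->
  (forall x, \esum_(i in [set: I]) (\1_(A i) x : R)%:E <= (N%:R : R)%:E)%E ->
  finite_set [set: I].
Proof.
move=> As AN.
apply: (@sub_finite_set _ _ (\bigcup_(z in [set` s]) [set i | A i z])) => [i _|].
  by have [z zs Az] := As i; exists z.
apply: bigcup_finite => [|z _]; first exact: finite_seq.
apply: contrapT => /(infinite_set_fset N.+1)[B BA NB].
have : ((N.+1%:R : R)%:E <= \esum_(i in [set: I]) (\1_(A i) z : R)%:E)%E.
  apply: esum_ge; exists [set` B]; first by split => //; exact: finite_fset.
  rewrite fsbig_finite; last exact: finite_fset.
  rewrite set_fsetK (eq_big_seq (fun=> 1%E)); last first.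
    by move=> i /BA Az; rewrite indicE mem_set.
  rewrite sumEFin lee_fin big_const_seq count_predT iter_addr_0 -[leRHS]mulr_natl
    mulr1.
  by rewrite ler_nat.
by move=> /le_trans/(_ (AN z)); rewrite lee_fin ler_nat ltnn.
Qed.

Lemma sum_indic_count (I : Type) (s : seq I) (A : I -> set X) (x : X) :
  \sum_(i <- s) (\1_(A i) x : R)%:E = ((count (fun i => x \in A i) s)%:R : R)%:E.
Proof.
elim: s => [|i s IH]; first by rewrite big_nil.
by rewrite big_cons IH /= indicE natrD EFinD; case: (x \in A i).
Qed.

Context (mu : {measure set X -> \bar R}).
Context (rho : nat -> {finite_measure set (X * X)%type -> \bar R}) (p a : R).

(** In a compact space the coverings of the cutoff condition are finite: every
    centre is close to a point of a finite net. *)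
Lemma finite_cutoff : controlled_cutoff mu rho p a ->
  exists (C : R) (N : nat), 0 < C /\ forall e : R, 0 < e ->
  exists (I : choiceType) (s : seq I) (c : I -> X) (phi : I -> X -> R),
  [/\ forall x, exists2 i, i \in s & mdist (c i) x < e,
      forall x, (count (fun i => (mdist (c i) x < 5 * e)%R) s <= N)%N,
      forall i, [/\ Fp rho p (phi i), forall x, 0 <= phi i x <= 1,
        forall x, 2 * e <= mdist (c i) x -> phi i x = 0 &
        (limn_esup (fun n => nu rho p n (phi i) [set: X]) <=
          (C / e `^ (a * p))%:E * mu (ball (c i) e))%E] &
      forall x, \sum_(i <- s) phi i x = 1].
Proof.
case=> C [N [C0 H]]; exists C, N; split => // e e0.
have [I [c [phi [cov ov phiP sum1]]]] := H e e0.
have [net netP] := finite_net X_compact e0.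
have fI : finite_set [set: I].
  apply: (esum_bound_finite (A := fun i => ball (c i) (5 * e)) (N := N) (s := net))
    => // i.
  have [z zs zc] := netP (c i); exists z => //.
  by rewrite mem_ball metric_sym; lra.
exists I, (finmap.enum_fset (fset_set [set: I])), c, phi.
split => [x|x|i|x].
- have : [set: X] x by []. 
  rewrite -cov => -[i _]; rewrite mem_ball => cx; exists i => //.
  by rewrite in_fset_set//; exact: mem_set.
- have := ov x; rewrite esum_fset// fsbig_finite// sum_indic_count lee_fin ler_nat.
  by under eq_count do rewrite in_ballE.
- have [Fi phi01 phi0 phiC] := phiP i; split => // x cx; apply: phi0.
  by rewrite mem_ball; apply/negP; rewrite -leNgt.
- have := sum1 x; rewrite esum_fset//; last first.
    by move=> i _; rewrite lee_fin; have [_ /(_ x)/andP[]] := phiP i.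
  by rewrite fsbig_finite// sumEFin => -[].
Qed.

End finite_partition.

(** * The energy of a function under the Poincare inequality *)

Section energy_upper_bound.
Context (d : measure_display) (R : realType) (X : borelMetricType d R).
Context (mu : {measure set X -> \bar R}) (p : R).
Context (X_compact : compact [set: X]) (mu_finite : (mu [set: X] < +oo)%E).
Context (mu_doubling : doubling mu) (p_ge1 : 1 <= p).
Implicit Types (x y z : X) (r e : R) (f : X -> R).
Local Open Scope ereal_scope.

Local Notation vol := (vol mu).
Local Notation osc := (osc mu p).

Let p_gt0 : (0 < p)%R. Proof. by rewrite (lt_le_trans ltr01). Qed.

Lemma integral_powR_shift (D : set X) f (b m : R) :
  measurable D -> measurable_fun [set: X] f ->
  \int[mu]_(y in D) (`|f y - b| `^ p)%:E <=
  (2 `^ p)%:E * (\int[mu]_(y in D) (`|f y - m| `^ p)%:E + (`|m - b| `^ p)%:E * mu D).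
Proof.
move=> mD mf; have mfD : measurable_fun D f by exact: measurable_funTS.
have mfm : measurable_fun D (fun y => (`|f y - m| `^ p)%:E).
  exact: measurable_powR_norm.
apply: (@le_trans _ _ (\int[mu]_(y in D) ((2 `^ p)%:E *
    ((`|f y - m| `^ p)%:E + cst (`|m - b| `^ p)%:E y)))).
  apply: ge0_integral_mono => y _; first by rewrite lee_fin powR_ge0.
  rewrite -EFinD -EFinM lee_fin (_ : f y - b = (f y - m) + (m - b))%R.
    exact: powR_normD_le.
  by rewrite addrA subrK.
have c0 (x : X) : 0 <= cst (`|m - b| `^ p)%:E x by rewrite lee_fin powR_ge0.
have f0 (x : X) : 0 <= (`|f x - m| `^ p)%:E by rewrite lee_fin powR_ge0.
rewrite ge0_integralZl//.
- by rewrite ge0_integralD// integral_cst.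
- by apply: emeasurable_funD => //; exact: measurable_cst.
- by move=> y _; rewrite adde_ge0.
Qed.

(** On a ball of radius [r] the averages over smaller balls are compared with
    the average over the ball of radius [2 * r], which contains all of them. *)
Lemma integral_osc_ball_le : exists2 K : R, (0 < K)%R &
  forall f (c : X) r, (0 < r)%R -> f \in Lfun mu p%:E ->
  \int[mu]_(x in ball c r) osc f r x <= K%:E *
  \int[mu]_(y in ball c (2 * r)%R) (`|f y - average mu f (ball c (2 * r)%R)| `^
    p)%:E.
Proof.
have [K K0 dK] := doubling_ball mu_finite mu_doubling 1 2.
exists (K * 2 `^ p * 2)%R; first by rewrite !mulr_gt0// powR_gt0.
move=> f c r r0 fL; have mf := Lfun_measurable fL.
set m := average _ _ _; set V := (X in _ <= _ * X).
have mB r' : measurable (ball c r') by exact: measurable_metric_ball.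
have V0 : 0 <= V by apply: integral_ge0 => y _; rewrite lee_fin powR_ge0.
have r20 : (0 < 2 * r)%R by rewrite mulr_gt0.
have v0 : (0 < vol c (2 * r))%R by rewrite vol_gt0.
pose W := (vol c (2 * r))^-1%:E * V.
have W0 : 0 <= W by rewrite mule_ge0// lee_fin invr_ge0 ltW.
have step x : ball c r x ->
    osc f r x <= (K * 2 `^ p)%:E * (W + (`|f x - m| `^ p)%:E).
  rewrite mem_ball => cx;
    have xc : (mdist x c < 1 * r)%R by rewrite mul1r metric_sym.
  have vx : (0 < vol x r)%R by rewrite vol_gt0.
  have vv : ((vol x r)^-1 <= K * (vol c (2 * r))^-1)%R.
    rewrite ler_pdivlMr// ler_pdivrMl// [leRHS]mulrC; exact: dK.
  have sub : ball x r `<=` ball c (2 * r) by apply: ball_subset; lra.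
  apply: (@le_trans _ _ ((K * (vol c (2 * r))^-1)%:E *
     \int[mu]_(y in ball c (2 * r)) (`|f y - f x| `^ p)%:E)).
    apply: lee_pmul => //; rewrite ?lee_fin ?invr_ge0 ?(ltW vx)//.
      by apply: integral_ge0 => y _; rewrite lee_fin powR_ge0.
    by apply: ge0_integral_subset => // y; rewrite lee_fin powR_ge0.
  apply: (@le_trans _ _ ((K * (vol c (2 * r))^-1)%:E * ((2 `^ p)%:E *
     (V + (`|m - f x| `^ p)%:E * mu (ball c (2 * r)))))).
    apply: lee_wpmul2l; first by rewrite lee_fin mulr_ge0 ?invr_ge0 ?(ltW K0) ?(ltW
      v0).
    exact: integral_powR_shift.
  rewrite volE// distrC le_eqVlt; apply/orP; left; apply/eqP.
  rewrite muleA -EFinM mulrAC EFinM -muleA; congr (_ * _).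
  rewrite ge0_muleDr//; last by rewrite -EFinM lee_fin mulr_ge0 ?powR_ge0 ?(ltW v0).
  congr (_ + _); rewrite -!EFinM; congr (_%:E); field; exact: lt0r_neq0.
have mosc : measurable_fun (ball c r) (osc f r).
  by apply: measurable_funTS; exact: measurable_osc.
have mfm : measurable_fun (ball c r) (fun y => (`|f y - m| `^ p)%:E).
  by apply: measurable_powR_norm; exact: measurable_funTS.
apply: (@le_trans _ _ (\int[mu]_(x in ball c r)
    ((K * 2 `^ p)%:E * (cst W x + (`|f x - m| `^ p)%:E)))).
  by apply: ge0_integral_mono => [x _|]; first exact: osc_ge0.
have Kp : (0 <= K * 2 `^ p)%R by rewrite mulr_ge0 ?powR_ge0 ?(ltW K0).
rewrite ge0_integralZl//; last 2 first.
- by apply: emeasurable_funD => //; exact: measurable_cst.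
- by move=> x _; rewrite adde_ge0// lee_fin powR_ge0.
rewrite [(_ * _)%:E in leRHS]EFinM -[leRHS]muleA; apply: lee_wpmul2l;
  first by rewrite lee_fin.
rewrite ge0_integralD//.
rewrite integral_cst// (_ : 2%:E * V = V + V); last first.
  by rewrite -[in RHS](mul1e V) -ge0_muleDl// -EFinD.
apply: leeD.
  rewrite volE// /W muleAC -EFinM -[leRHS]mul1e; apply: lee_wpmul2r => //.
  rewrite lee_fin ler_pdivrMl// mulr1; apply: vol_subset => //.
  by rewrite mdistxx; lra.
apply: ge0_integral_subset => //.
by apply: ball_subset; rewrite mdistxx; lra.
Qed.

Context (a : R) (rho : nat -> {finite_measure set (X * X)%type -> \bar R}).
Context (rho_poincare : poincare mu rho p a).
Context (rho_cutoff : controlled_cutoff mu rho p a).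

Lemma nu_ge0 n f A : 0 <= nu rho p n f A.
Proof. by apply: integral_ge0 => z _; rewrite lee_fin powR_ge0. Qed.

Lemma measurable_powR_diff (D : set (X * X)) f : measurable_fun [set: X] f ->
  measurable_fun D (fun z : X * X => (`|f z.1 - f z.2| `^ p)%:E).
Proof.
move=> mf; apply: measurable_funTS; apply/measurable_EFinP.
apply: (measurableT_comp (measurable_powR p)).
apply: measurableT_comp => //; apply: measurable_funB.
  exact: (measurableT_comp mf measurable_fst).
exact: (measurableT_comp mf measurable_snd).
Qed.

Lemma Fp_Lfun f : Fp rho p f -> f \in Lfun mu p%:E.
Proof. by move=> [cf _]; exact: continuous_Lfun. Qed.

Lemma sum_nu_ball_le (N : nat) (I : Type) (s : seq I) (c : I -> X) r n f :
  measurable_fun [set: X] f ->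
  (forall x, (count (fun i => (mdist (c i) x < r)%R) s <= N)%N) ->
  \sum_(i <- s) nu rho p n f (ball (c i) r) <= N%:R%:E * nu rho p n f [set: X].
Proof.
move=> mf sN; rewrite /nu setXTT; apply: sum_integral_le_overlap.
- by move=> i; apply: measurableX => //; exact: measurable_metric_ball.
- exact: measurable_powR_diff.
- by move=> z; rewrite lee_fin powR_ge0.
- move=> z; apply: leq_trans (sN z.1); apply: sub_count => i /=.
  by move=> /set_mem[]; rewrite mem_ball.
Qed.

(** The balls of radius [r] cover the space, the Poincare inequality acts on
    the balls of radius [2 * r], and the balls of radius [lam * 2 * r] on its
    right-hand side overlap boundedly; lower limits are superadditive, so the
    sum over the balls can be taken inside. *)
Lemma integral_osc_le_liminf_nu : exists2 K : R, (0 < K)%R &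
  forall f r, Fp rho p f -> (0 < r)%R ->
  \int[mu]_x osc f r x <=
  (K * r `^ (p * a))%:E * limn_einf (fun n => nu rho p n f [set: X]).
Proof.
have [K K0 HK] := integral_osc_ball_le.
have [C [lam [C0 lam1 HP]]] := rho_poincare.
have [C' [N [_ cut]]] := finite_cutoff X_compact rho_cutoff.
have lam0 : (0 <= lam * 2)%R by lra.
have [N' HN'] := overlap_enlarge mu_finite mu_doubling N lam0.
exists (K * (C * 2 `^ (p * a)) * N'.+1%:R)%R.
  by rewrite !mulr_gt0// powR_gt0.
move=> f r Ff r0; have [cf _] := Ff; have mf := continuous_measurable cf.
have [I [s [c [_ [cov ov _ _]]]]] := cut r r0.
have {}ov := HN' r I s c r0 ov.
have Z0 : (0 <= K * (C * (2 * r) `^ (p * a)))%R.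
  by rewrite !mulr_ge0 ?powR_ge0 ?(ltW K0) ?(ltW C0).
apply: (@le_trans _ _ (\sum_(i <- s) \int[mu]_(x in ball (c i) r) osc f r x)).
  apply: integral_le_sum_cover.
  - by move=> i; exact: measurable_metric_ball.
  - exact: measurable_osc.
  - by move=> x; exact: osc_ge0.
  - by move=> x; have [i si cx] := cov x; exists i => //; rewrite mem_ball.
apply: (@le_trans _ _ (\sum_(i <- s) (K * (C * (2 * r) `^ (p * a)))%:E *
    limn_einf (fun n => nu rho p n f (ball (c i) (lam * 2 * r)%R)))).
  apply: lee_sum => i _; apply: le_trans (HK f (c i) r r0 (Fp_Lfun Ff)) _.
  rewrite EFinM -muleA; apply: lee_wpmul2l; first by rewrite lee_fin ltW.
  rewrite -mulrA; apply: HP => //; by rewrite mulr_gt0.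
rewrite -ge0_sume_distrr; last first.
  by move=> i _; apply: limf_einf_ge0 => n; exact: nu_ge0.
have -> : (K * (C * 2 `^ (p * a)) * N'.+1%:R * r `^ (p * a))%R =
    (K * (C * (2 * r) `^ (p * a)) * N'.+1%:R)%R.
  by rewrite powRM ?(ltW r0)//; ring.
rewrite [(_ * _)%:E in leRHS]EFinM -[leRHS]muleA; apply: lee_wpmul2l;
  first by rewrite lee_fin.
rewrite limn_einf_filter; under eq_bigr do rewrite limn_einf_filter.
apply: (le_trans (@limf_einf_sum_ge _ _ R I s
  (fun i n => nu rho p n f (ball (c i) (lam * 2 * r)%R)) \oo _
  (fun i n => nu_ge0 n f _))).
apply: le_trans (@limf_einfZ_le _ _ R (fun n => nu rho p n f [set: X]) \oo
  N'.+1%:R _ (fun n => nu_ge0 n f _)) => //.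
apply: limf_einf_le; apply: nearW => n.
apply: le_trans (sum_nu_ball_le n mf ov) _.
by apply: lee_wpmul2r; [exact: nu_ge0|rewrite lee_fin ler_nat].
Qed.

End energy_upper_bound.

(** * Pairs of distant points *)

Section far_pairs.
Context (d : measure_display) (R : realType) (X : borelMetricType d R).
Context (X_compact : compact [set: X]).
Context (rho : nat -> {finite_measure set (X * X)%type -> \bar R}).
Context (rho_kernel : local_kernel rho).
Implicit Types (x y z : X) (e : R).

Lemma open_metric_ball_compl x (r : R) : open [set y | r < mdist x y].
Proof.
rewrite openE => y /= xy; rewrite /interior.
apply/nbhs_ballP; exists (mdist x y - r) => /=; first by rewrite subr_gt0.
by move=> z; rewrite mem_ball/=; have := metric_triangle x z y;
  rewrite (metric_sym z y); lra.
Qed.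

Lemma measure_bigsetU_le (I : Type) (s : seq I) (F : I -> set (X * X)) n :
  (forall i, measurable (F i)) ->
  (rho n (\big[setU/set0]_(i <- s) F i) <= \sum_(i <- s) rho n (F i))%E.
Proof.
move=> mF; elim: s => [|i s IH]; first by rewrite !big_nil measure0.
rewrite !big_cons; apply: le_trans (measureU2 _ _ _) _ => //.
  exact: bigsetU_measurable.
exact: leeD2l.
Qed.

Lemma near_sum_small (I : Type) (s : seq I) (u : I -> nat -> \bar R) (h : R) :
  0 < h -> (forall i, u i n @[n --> \oo] --> 0%E) ->
  \forall n \near \oo, (\sum_(i <- s) u i n <= h%:E)%E.
Proof.
move=> + u0; elim: s h => [|i s IH] h h0.
  by apply: nearW => n; rewrite big_nil lee_fin ltW.
have h20 : 0 < h / 2 by lra.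
have [_ ui] := cvg_limn_einf_sup (u0 i).
have : (limf_esup (u i) \oo < (h / 2)%:E)%E by rewrite [limf_esup _ _]ui lte_fin.
move=> /limf_esup_lt near_i; near=> n.
rewrite big_cons (splitr h) EFinD; apply: leeD; last by near: n; exact: IH.
by apply: ltW; near: n; exact: near_i.
Unshelve. all: by end_near. Qed.

(** The pairs at distance at least [e] are covered by finitely many products
    of closed sets at positive distance, one for each point of a fine net. *)
Lemma far_mass_small e (h : R) : 0 < e -> 0 < h ->
  \forall n \near \oo, (rho n [set z : X * X | (e <= mdist z.1 z.2)%R] <= h%:E)%E.
Proof.
move=> e0 h0; have e4 : 0 < e / 4 by lra.
have [s sP] := finite_net X_compact e4.
pose A z : set X := ~` [set y | e / 4 < mdist z y].
pose B z : set X := ~` ball z (3 / 4 * e).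
have cA z : closed (A z) by apply: open_closedC; exact: open_metric_ball_compl.
have cB z : closed (B z) by apply: open_closedC; exact: open_metric_ball.
have mA z : measurable (A z).
  by apply: measurableC; apply: measurable_open; exact: open_metric_ball_compl.
have mB z : measurable (B z) by apply: measurableC; exact: measurable_metric_ball.
have dAB z : (0 < set_dist (A z) (B z))%E.
  apply: (@lt_le_trans _ _ (e / 2)%:E); first by rewrite lte_fin; lra.
  apply: le_ereal_inf_tmp => _ [x Ax [y By <-]]; rewrite lee_fin.
  move: Ax By; rewrite /A /B /= mem_ball => /negP; rewrite -leNgt => zx.
  move=> /negP; rewrite -leNgt => zy.
  by have := metric_triangle z x y; lra.
have near_s := @near_sum_small _ s (fun z n => rho n (A z `*` B z)) h h0
  (fun z => rho_kernel.2 _ _ (cA z) (cB z) (dAB z)).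
apply: filterS near_s => n; apply: le_trans.
apply: le_trans (measure_bigsetU_le s n _); last by move=> z; exact: measurableX.
apply: le_measure; rewrite ?inE.
- rewrite (_ : mkset _ = ~` [set z : X * X | mdist z.1 z.2 < e]).
    by apply: measurableC; exact: measurable_near_diagonal.
  by apply/seteqP; split => z /=; rewrite leNgt => /negP.
- by apply: bigsetU_measurable => z _; exact: measurableX.
move=> [x y] /= exy; have [z zs zx] := sP x.
rewrite -bigcup_seq; exists z => //=; split; rewrite /A /B /=.
  by apply/negP; rewrite -leNgt ltW.
rewrite mem_ball; apply/negP; rewrite -leNgt.
by have := metric_triangle x z y; rewrite (metric_sym x z); lra.
Qed.

End far_pairs.

(** * Averages and regularization *)

Section averages.
Context (d : measure_display) (R : realType) (X : borelMetricType d R).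
Context (mu : {measure set X -> \bar R}) (p : R).
Context (X_compact : compact [set: X]) (mu_finite : (mu [set: X] < +oo)%E).
Context (mu_doubling : doubling mu) (p_ge1 : 1 <= p).
Implicit Types (x y z c : X) (r e : R) (f : X -> R).
Local Open Scope ereal_scope.

Local Notation vol := (vol mu).
Local Notation osc := (osc mu p).

Lemma average_powR_le f (b : R) c e : (0 < e)%R -> f \in Lfun mu p%:E ->
  (`|average mu f (ball c e) - b| `^ p)%:E * mu (ball c e) <=
  \int[mu]_(y in ball c e) (`|f y - b| `^ p)%:E.
Proof.
move=> e0 fL; apply: powR_mean_le => //.
- exact: measurable_metric_ball.
- by rewrite volE// lte_fin vol_gt0.
- by rewrite volE// ltry.
- exact: Lfun_ball_integrable fL.
Qed.

(** Radius [6 * e] is large enough for the ball around [x] to contain the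
    ball over which [f] is averaged. *)
Lemma average_center_le : exists2 K : R, (0 < K)%R &
  forall f e c x, (0 < e)%R -> f \in Lfun mu p%:E -> (mdist c x < 5 * e)%R ->
  (`|average mu f (ball c e) - f x| `^ p)%:E <= K%:E * osc f (6 * e) x.
Proof.
have [K K0 dK] := doubling_ball mu_finite mu_doubling 5 6.
exists K => // f e c x e0 fL cx.
have vc : (0 < vol c e)%R by rewrite vol_gt0.
have vx : (0 < vol x (6 * e))%R by rewrite vol_gt0// mulr_gt0.
have := average_powR_le (f x) c e0 fL; rewrite volE// -lee_pdivlMr// => /le_trans;
  apply.
rewrite muleC /osc muleA -EFinM; apply: lee_pmul.
- by rewrite lee_fin invr_ge0 ltW.
- by apply: integral_ge0 => y _; rewrite lee_fin powR_ge0.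
- by rewrite lee_fin ler_pdivlMr// ler_pdivrMl// [leRHS]mulrC; exact: dK.
- apply: ge0_integral_subset => [y|]; first by rewrite lee_fin powR_ge0.
  by apply: ball_subset; rewrite metric_sym; lra.
Qed.

(** Jensen's inequality on the second ball, with the first average as the
    constant, reduces the difference of two averages to the difference of an
    average and a nearby value. *)
Lemma average_pair_le : exists2 K : R, (0 < K)%R &
  forall f e c c', (0 < e)%R -> f \in Lfun mu p%:E -> (mdist c c' < 4 * e)%R ->
  (`|average mu f (ball c e) - average mu f (ball c' e)| `^ p)%:E * mu (ball c e)
  <= K%:E * \int[mu]_(x in ball c' e) osc f (6 * e) x.
Proof.
have [K K0 HK] := average_center_le.
have [K' K'0 dK] := doubling_ball mu_finite mu_doubling 4 1.
exists (K' * K)%R => [|f e c c' e0 fL cc']; first by rewrite mulr_gt0.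
have mf := Lfun_measurable fL.
set fc := average mu f (ball c e).
have vc' : (mu (ball c e) <= K'%:E * mu (ball c' e)).
  rewrite !volE// -EFinM lee_fin -{1}(mul1r e); apply: dK => //.
  by rewrite metric_sym.
apply: (@le_trans _ _ (K'%:E * \int[mu]_(x in ball c' e) (`|f x - fc| `^ p)%:E)).
  apply: le_trans (lee_wpmul2l _ vc') _; first by rewrite lee_fin powR_ge0.
  rewrite muleCA; apply: lee_wpmul2l; first by rewrite lee_fin ltW.
  by rewrite distrC; exact: average_powR_le.
rewrite EFinM -muleA; apply: lee_wpmul2l; first by rewrite lee_fin ltW.
rewrite -ge0_integralZl.
- apply: ge0_integral_mono => x; first by rewrite lee_fin powR_ge0.
  rewrite mem_ball => c'x; rewrite distrC; apply: HK => //.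
  by have := metric_triangle c c' x; lra.
- exact: measurable_metric_ball.
- by apply: measurable_funTS; exact: measurable_osc.
- by move=> x _; exact: osc_ge0.
- by rewrite lee_fin ltW.
Qed.

End averages.

Section regularization.
Context (d : measure_display) (R : realType) (X : borelMetricType d R).
Context (mu : {measure set X -> \bar R}) (p a : R).
Context (X_compact : compact [set: X]) (mu_finite : (mu [set: X] < +oo)%E).
Context (mu_doubling : doubling mu) (p_ge1 : 1 <= p).
Context (rho : nat -> {finite_measure set (X * X)%type -> \bar R}).
Context (rho_kernel : local_kernel rho).
Context (e : R) (e_gt0 : 0 < e) (C : R) (C_gt0 : 0 < C) (N : nat).
Context (I : choiceType) (s : seq I) (c : I -> X) (phi : I -> X -> R).
Context (cover : forall x, exists2 i, i \in s & mdist (c i) x < e).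
Context (overlap : forall x,
  (count (fun i => (mdist (c i) x < 5 * e)%R) s <= N)%N).
Context (phi_Fp : forall i, Fp rho p (phi i)).
Context (phi01 : forall i x, 0 <= phi i x <= 1).
Context (phi_supp : forall i x, 2 * e <= mdist (c i) x -> phi i x = 0).
Context (phi_nu : forall i, (limn_esup (fun n => nu rho p n (phi i) [set: X]) <=
          (C / e `^ (a * p))%:E * mu (ball (c i) e))%E).
Context (phi_sum1 : forall x, \sum_(i <- s) phi i x = 1).
Context (f : X -> R) (fL : f \in Lfun mu p%:E).
Implicit Types (x y : X) (r : R).

Local Notation vol := (vol mu).
Local Notation osc := (osc mu p).

Let p_gt0 : 0 < p. Proof. by rewrite (lt_le_trans ltr01). Qed.
Let mf : measurable_fun [set: X] f. Proof. exact: Lfun_measurable fL. Qed.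

Let mean i := average mu f (ball (c i) e).

Definition regularized x := \sum_(i <- s) mean i * phi i x.

Lemma regularized_continuous : continuous regularized.
Proof.
rewrite /regularized; elim: (s) => [|i t IH].
  rewrite (_ : (fun x => _) = cst 0); first by move=> x; exact: cvg_cst.
  by apply/funext => x; rewrite big_nil.
rewrite (_ : (fun x => _) =
    (fun x => mean i * phi i x + \sum_(j <- t) mean j * phi j x)); last first.
  by apply/funext => x; rewrite big_cons.
move=> x; apply: cvgD; last exact: IH.
by apply: cvgM; [exact: cvg_cst|exact: (phi_Fp i).1].
Qed.

(** As the [phi i] sum to [1], constants are preserved. *)
Lemma regularized_shift x (b : R) :
  regularized x - b = \sum_(i <- s) (mean i - b) * phi i x.
Proof.
under eq_bigr do rewrite mulrBl.
by rewrite sumrB -big_distrr/= phi_sum1 mulr1.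
Qed.

Lemma regularized_approx_le (K : R) : 0 < K ->
  (forall x i, mdist (c i) x < 5 * e ->
    ((`|mean i - f x| `^ p)%:E <= K%:E * osc f (6 * e) x)%E) ->
  (\int[mu]_x (`|regularized x - f x| `^ p)%:E <=
  (N%:R `^ p * (N%:R * K))%:E * \int[mu]_x osc f (6 * e) x)%E.
Proof.
move=> K0 HK; rewrite -ge0_integralZl//; last 3 first.
- exact: measurable_osc.
- by move=> x _; exact: osc_ge0.
- by rewrite lee_fin !mulr_ge0 ?powR_ge0// ltW.
apply: ge0_integral_mono => x _; first by rewrite lee_fin powR_ge0.
have -> : regularized x - f x =
    \sum_(i <- s | (mdist (c i) x < 5 * e)%R) (mean i - f x) * phi i x.
  rewrite regularized_shift [RHS]big_mkcond /=; apply: eq_bigr => i _.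
  case: ltP => // cx; rewrite phi_supp ?mulr0//.
  by apply: le_trans cx; rewrite ler_pM2r// ler_nat.
apply: (@le_trans _ _ (N%:R `^ p *
    \sum_(i <- s | (mdist (c i) x < 5 * e)%R) `|mean i - f x| `^ p)%:E).
  rewrite lee_fin; apply: le_trans (powR_norm_sum_le p_gt0 _ (overlap x)) _.
  apply: ler_wpM2l; first exact: powR_ge0.
  apply: ler_sum => i _; apply: ge0_ler_powR; rewrite ?nnegrE ?(ltW p_gt0)//.
  have /andP[h0 h1] := phi01 i x; rewrite normrM (ger0_norm h0).
  by rewrite ler_piMr.
rewrite EFinM (EFinM (N%:R `^ p)) -muleA; apply: lee_wpmul2l.
  by rewrite lee_fin powR_ge0.
rewrite -sumEFin.
apply: (@le_trans _ _ (\sum_(i <- s | (mdist (c i) x < 5 * e)%R) K%:E * osc f (6 *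
  e) x)%E).
  by apply: lee_sum => i; exact: HK.
rewrite EFinM -muleA sume_const_count; last first.
  by rewrite mule_ge0 ?osc_ge0// lee_fin ltW.
have o0 : (0 <= K%:E * osc f (6 * e) x)%E.
  by rewrite mule_ge0 ?osc_ge0// lee_fin ltW.
apply: lee_wpmul2r => //.
by rewrite lee_fin ler_nat.
Qed.

(** Zero for distant centres, so that the double sums below run over all
    pairs of indices. *)
Let weight i j : R :=
  if mdist (c i) (c j) < 4 * e then `|mean i - mean j| `^ p else 0.

Let weight_ge0 i j : 0 <= weight i j.
Proof. by rewrite /weight; case: ifP => // _; exact: powR_ge0. Qed.

(** Near the diagonal both points are close to one centre [c j]; subtracting
    [mean j] leaves only the boundedly many [i] with [c i] close to [c j]. *)
Lemma regularized_diff_near x y : mdist x y < e ->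
  `|regularized x - regularized y| `^ p <=
  N%:R `^ p * \sum_(j <- s) \sum_(i <- s) weight i j * `|phi i x - phi i y| `^ p.
Proof.
move=> xy; have [j js cjx] := cover x.
have -> : regularized x - regularized y =
    \sum_(i <- s | (mdist (c i) (c j) < 4 * e)%R)
      (mean i - mean j) * (phi i x - phi i y).
  have -> : regularized x - regularized y =
    (regularized x - mean j) - (regularized y - mean j) by ring.
  rewrite !regularized_shift -sumrB [RHS]big_mkcond /=; apply: eq_bigr => i _.
  rewrite -mulrBr; case: ltP => // cij.
  have -> : phi i x = 0.
    apply: phi_supp; have := metric_triangle (c i) x (c j).
    by move: e_gt0; rewrite (metric_sym x (c j)); lra.
  have -> : phi i y = 0; last by rewrite subrr mulr0.
  apply: phi_supp; have := metric_triangle (c i) y (c j).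
  have := metric_triangle y x (c j).
  by move: e_gt0; rewrite (metric_sym x (c j)) (metric_sym y x); lra.
have cN : (count (fun i => (mdist (c i) (c j) < 4 * e)%R) s <= N)%N.
  apply: leq_trans (overlap (c j)); apply: sub_count => i /= /lt_trans; apply.
  by rewrite ltr_pM2r// ltr_nat.
apply: le_trans (powR_norm_sum_le p_gt0 _ cN) _.
apply: ler_wpM2l; first exact: powR_ge0.
rewrite [leRHS](big_rem j js)/= -[leLHS]addr0; apply: lerD.
  rewrite big_mkcond /=; apply: ler_sum => i _.
  by rewrite /weight; case: ifP => _; rewrite ?mul0r// normrM powRM.
apply: sumr_ge0 => k _; apply: sumr_ge0 => i _.
by rewrite mulr_ge0 ?powR_ge0.
Qed.

(** Pairs at distance at least [e] are controlled by the supremum [B] of the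
    regularized function. *)
Lemma regularized_nu_le : exists2 M : R, 0 < M & forall n,
  (nu rho p n regularized [set: X] <=
  (N%:R `^ p)%:E * (\sum_(j <- s) \sum_(i <- s)
    (weight i j)%:E * nu rho p n (phi i) [set: X])
  + M%:E * rho n [set z : X * X | (e <= mdist z.1 z.2)%R])%E.
Proof.
have [B B0 gB] := continuous_bounded X_compact regularized_continuous.
exists ((2 * B) `^ p) => [|n]; first by rewrite powR_gt0// mulr_gt0.
have mphi i : measurable_fun [set: X] (phi i).
  exact: continuous_measurable (phi_Fp i).1.
pose far := [set z : X * X | e <= mdist z.1 z.2].
have mfar : measurable far.
  rewrite (_ : far = ~` [set z : X * X | mdist z.1 z.2 < e]).
    by apply: measurableC; exact: measurable_near_diagonal.
  by apply/seteqP; split => z /=; rewrite /far /= leNgt => /negP.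
pose h i (z : X * X) : \bar R := (`|phi i z.1 - phi i z.2| `^ p)%:E.
have h0 i z : (0 <= h i z)%E by rewrite lee_fin powR_ge0.
have mh i : measurable_fun [set: X * X] (h i) by exact: measurable_powR_diff.
have m0 i j : (0 <= (weight i j)%:E)%E by rewrite lee_fin.
have mmh i j : measurable_fun [set: X * X] (fun z => (weight i j)%:E * h i z)%E.
  by apply: emeasurable_funM => //; exact: measurable_cst.
pose G (z : X * X) : \bar R := (\sum_(j <- s) \sum_(i <- s) (weight i j)%:E * h i
  z)%E.
have G0 z : (0 <= G z)%E.
  by apply: sume_ge0 => j _; apply: sume_ge0 => i _; rewrite mule_ge0.
have mG : measurable_fun [set: X * X] G.
  by apply: emeasurable_sum => j; exact: emeasurable_sum.
have IG : (\int[rho n]_z G z = \sum_(j <- s) \sum_(i <- s)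
    (weight i j)%:E * nu rho p n (phi i) [set: X])%E.
  rewrite /G ge0_integral_sum//; last 2 first.
  - by move=> j; exact: emeasurable_sum.
  - by move=> j z _; apply: sume_ge0 => i _; rewrite mule_ge0.
  apply: eq_bigr => j _; rewrite ge0_integral_sum//; last first.
    by move=> i z _; rewrite mule_ge0.
  by apply: eq_bigr => i _; rewrite ge0_integralZl// /nu setXTT.
rewrite -IG -ge0_integralZl//.
have -> : (((2 * B) `^ p)%:E * rho n far =
    \int[rho n]_z ((2 * B) `^ p * \1_far z)%:E)%E.
  under eq_integral do rewrite EFinM.
  rewrite ge0_integralZl ?integral_indic ?setIT//.
  - by apply/measurable_EFinP; exact: measurable_indic.
  - by rewrite lee_fin powR_ge0.
rewrite -ge0_integralD//; last 4 first.
- by move=> z _; rewrite mule_ge0// lee_fin powR_ge0.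
- by apply: emeasurable_funM => //; exact: measurable_cst.
- by move=> z _; rewrite lee_fin mulr_ge0 ?powR_ge0.
- apply/measurable_EFinP; apply: measurable_funM; first exact: measurable_cst.
  exact: measurable_indic.
rewrite /nu setXTT; apply: ge0_integral_mono => z _;
  first by rewrite lee_fin powR_ge0.
have [zfar|znear] := leP e (mdist z.1 z.2).
  rewrite indicE mem_set// mulr1 -[leLHS]add0e; apply: leeD.
    by rewrite mule_ge0// lee_fin powR_ge0.
  rewrite lee_fin; apply: ge0_ler_powR; rewrite ?nnegrE ?(ltW p_gt0)//.
    by rewrite mulr_ge0 ?(ltW B0).
  apply: le_trans (ler_normB _ _) _.
  by have := gB z.1; have := gB z.2; lra.
rewrite -[leLHS]adde0; apply: leeD; last by rewrite lee_fin mulr_ge0 ?powR_ge0.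
have := regularized_diff_near znear; rewrite -lee_fin => /le_trans; apply.
rewrite EFinM; apply: lee_wpmul2l; first by rewrite lee_fin powR_ge0.
rewrite -sumEFin; apply: lee_sum => j _; rewrite -sumEFin.
by apply: lee_sum => i _; rewrite EFinM.
Qed.

Lemma regularized_Fp : Fp rho p regularized.
Proof.
split; first exact: regularized_continuous.
have mphi i : measurable_fun [set: X] (phi i).
  exact: continuous_measurable (phi_Fp i).1.
have sup_ge0 i : (0 <= ereal_sup (range (fun n => nu rho p n (phi i) [set: X])))%E.
  by apply: le_trans (ereal_sup_ubound _); last (by exists 0%N); exact: nu_ge0.
apply: (@le_lt_trans _ _ (((size s)%:R `^ p)%:E * \sum_(i <- s) (`|mean i| `^ p)%:E *
    ereal_sup (range (fun n => nu rho p n (phi i) [set: X]))))%E; last first.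
  apply: lte_mul_pinfty; rewrite ?lee_fin ?powR_ge0//.
  elim: (s) => [|i t IH]; first by rewrite big_nil.
  rewrite big_cons; apply: lte_add_pinfty => //.
  by apply: lte_mul_pinfty; rewrite ?lee_fin ?powR_ge0//; exact: (phi_Fp i).2.
apply: ge_ereal_sup => _ [n _ <-].
apply: (@le_trans _ _ (((size s)%:R `^ p)%:E * \sum_(i <- s) (`|mean i| `^ p)%:E *
    nu rho p n (phi i) [set: X])%E); last first.
  apply: lee_wpmul2l; first by rewrite lee_fin powR_ge0.
  apply: lee_sum => i _; apply: lee_wpmul2l; first by rewrite lee_fin powR_ge0.
  by apply: ereal_sup_ubound; exists n.
pose h i (z : X * X) : \bar R := (`|phi i z.1 - phi i z.2| `^ p)%:E.
have h0 i z : (0 <= h i z)%E by rewrite lee_fin powR_ge0.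
have mh i : measurable_fun [set: X * X] (h i) by exact: measurable_powR_diff.
have mmh i : measurable_fun [set: X * X] (fun z => (`|mean i| `^ p)%:E * h i z)%E.
  by apply: emeasurable_funM => //; exact: measurable_cst.
have m0 i : (0 <= (`|mean i| `^ p)%:E)%E by rewrite lee_fin powR_ge0.
have -> : (\sum_(i <- s) (`|mean i| `^ p)%:E * nu rho p n (phi i) [set: X] =
    \int[rho n]_z \sum_(i <- s) (`|mean i| `^ p)%:E * h i z)%E.
  rewrite ge0_integral_sum//; last by move=> i z _; rewrite mule_ge0.
  by apply: eq_bigr => i _; rewrite ge0_integralZl// /nu setXTT.
rewrite -ge0_integralZl//; last 2 first.
- exact: emeasurable_sum.
- by move=> z _; apply: sume_ge0 => i _; rewrite mule_ge0.
rewrite /nu setXTT; apply: ge0_integral_mono => z _;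
  first by rewrite lee_fin powR_ge0.
rewrite -sumrB.
have := @powR_norm_sum_le _ _ p_gt0 I s predT
  (fun i => mean i * phi i z.1 - mean i * phi i z.2) (size s) (count_size _ _).
rewrite -lee_fin => /le_trans; apply.
rewrite EFinM; apply: lee_wpmul2l; first by rewrite lee_fin powR_ge0.
rewrite -sumEFin; apply: lee_sum => i _.
by rewrite -mulrBr normrM powRM// EFinM.
Qed.

Let count_near (r : R) x : r <= 5 * e ->
  (count (fun i => (mdist (c i) x < r)%R) s <= N)%N.
Proof.
move=> r5; apply: leq_trans (overlap x); apply: sub_count => i /= /lt_le_trans.
exact.
Qed.

(** The bound on the upper limit is positive, so its double is eventually a
    bound, simultaneously for the finitely many indices. *)
Let near_nu_phi : \forall n \near \oo, forall i, i \in s ->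
  (nu rho p n (phi i) [set: X] <= (2 * C / e `^ (a * p))%:E * mu (ball (c i) e))%E.
Proof.
elim: (s) => [|i t IH]; first by apply: nearW.
have Ce : 0 < C / e `^ (a * p) by rewrite divr_gt0// powR_gt0.
have : (limf_esup (fun n => nu rho p n (phi i) [set: X]) \oo <
    (2 * C / e `^ (a * p))%:E * mu (ball (c i) e))%E.
  apply: le_lt_trans (phi_nu i) _; rewrite volE// -!EFinM lte_fin.
  by rewrite ltr_pM2r ?vol_gt0// -mulrA; lra.
move=> /limf_esup_lt near_i; near=> n => k; rewrite inE => /predU1P[->|].
  by apply: ltW; near: n; exact: near_i.
by move: k; near: n; exact: IH.
Unshelve. all: by end_near. Qed.

(** The mass of the distant pairs tends to [0].  For the others, summing first
    over the at most [N] indices [i] near [j] and then over [j] costs the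
    factor [N] twice: once per index, once for the overlap of the balls. *)
Lemma regularized_liminf_nu_le (K : R) : 0 < K ->
  (forall i j, mdist (c i) (c j) < 4 * e ->
    ((`|mean i - mean j| `^ p)%:E * mu (ball (c i) e) <=
     K%:E * \int[mu]_(x in ball (c j) e) osc f (6 * e) x)%E) ->
  (limn_einf (fun n => nu rho p n regularized [set: X]) <=
  (N%:R `^ p * (2 * C / e `^ (a * p) * (N%:R * (K * N%:R))))%:E *
    \int[mu]_x osc f (6 * e) x)%E.
Proof.
move=> K0 HK; set J := (\int[mu]_x _)%E; set A := (_ * J)%E.
have osc0 x : (0 <= osc f (6 * e) x)%E by exact: osc_ge0.
have J0 : (0 <= J)%E by exact: integral_ge0.
have Ce : 0 < 2 * C / e `^ (a * p) by rewrite divr_gt0 ?powR_gt0// mulr_gt0.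
have [M M0 HM] := regularized_nu_le.
apply/lee_addgt0Pr => h h0.
rewrite limn_einf_filter; apply: limf_einf_ub.
have hM : 0 < h / M by rewrite divr_gt0.
have near_far := far_mass_small X_compact rho_kernel e_gt0 hM.
near=> n; apply: (le_trans (HM n)); apply: leeD; last first.
  apply: (@le_trans _ _ (M%:E * (h / M)%:E)%E).
    apply: lee_wpmul2l; first by rewrite lee_fin ltW.
    by near: n; exact: near_far.
  by rewrite -EFinM lee_fin mulrC divfK// gt_eqF.
rewrite /A EFinM -muleA; apply: lee_wpmul2l; first by rewrite lee_fin powR_ge0.
apply: (@le_trans _ _ (\sum_(j <- s) (2 * C / e `^ (a * p) * (N%:R * K))%:E *
    \int[mu]_(x in ball (c j) e) osc f (6 * e) x)%E).
  apply: lee_sum => j _.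
  set Oj := (\int[mu]_(x in _) _)%E.
  have O0 : (0 <= Oj)%E by exact: integral_ge0.
  apply: (@le_trans _ _ (\sum_(i <- s | (mdist (c i) (c j) < 4 * e)%R)
      (2 * C / e `^ (a * p) * K)%:E * Oj)%E).
    rewrite [leRHS]big_mkcond/= big_seq [leRHS]big_seq; apply: lee_sum => i si.
    rewrite /weight; case: ifP => cij; last by rewrite mul0e.
    apply: (@le_trans _ _ ((`|mean i - mean j| `^ p)%:E *
        ((2 * C / e `^ (a * p))%:E * mu (ball (c i) e)))%E).
      apply: lee_wpmul2l; first by rewrite lee_fin powR_ge0.
      by move: i si {cij}; near: n; exact: near_nu_phi.
    rewrite muleCA [(_ * K)%:E]EFinM -[leRHS]muleA; apply: lee_wpmul2l;
      last exact: HK.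
    by rewrite lee_fin ltW.
  have CK0 : (0 <= (2 * C / e `^ (a * p) * K)%:E * Oj)%E.
    by rewrite mule_ge0// lee_fin mulr_ge0 ?ltW.
  rewrite sume_const_count//.
  rewrite mulrCA [in leRHS]EFinM -[leRHS]muleA; apply: lee_wpmul2r => //.
  rewrite lee_fin ler_nat; apply: count_near.
  by rewrite ler_pM2r// ler_nat.
rewrite -ge0_sume_distrr; last by move=> j _; exact: integral_ge0.
rewrite (mulrA N%:R K) [in leRHS]mulrA [in leRHS]EFinM -[leRHS]muleA.
apply: lee_wpmul2l.
  by rewrite lee_fin (mulr_ge0 (ltW Ce))// mulr_ge0// ltW.
apply: sum_integral_le_overlap => //.
- by move=> j; exact: measurable_metric_ball.
- exact: measurable_osc.
move=> x; under eq_count do rewrite in_ballE.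
by apply: count_near; rewrite ler_peMl// ?ler1n// ltW.
Unshelve. all: by end_near. Qed.

End regularization.

(** * Relaxation *)

Lemma powR_small (R : realType) (q k h : R) : 0 < q -> 0 <= k -> 0 < h ->
  exists2 b : R, 0 < b & forall r : R, 0 < r -> r < b -> r `^ q * k <= h.
Proof.
move=> q0 k0 h0; have k1 : 0 < k + 1 by rewrite ltr_wpDl.
exists ((h / (k + 1)) `^ q^-1) => [|r r0 rb]; first by rewrite powR_gt0// divr_gt0.
have : r `^ q <= h / (k + 1).
  have -> : h / (k + 1) = ((h / (k + 1)) `^ q^-1) `^ q.
    by rewrite -powRrM mulVf ?lt0r_neq0// powRr1// divr_ge0// ltW.
  apply: ge0_ler_powR; rewrite ?nnegrE ?powR_ge0//; exact: ltW.
rewrite ler_pdivlMr// => /(le_trans _); apply.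
by rewrite ler_wpM2l ?powR_ge0// lerDl.
Qed.

Section relaxation.
Context (d : measure_display) (R : realType) (X : borelMetricType d R).
Context (mu : {measure set X -> \bar R}) (p a : R).
Context (X_compact : compact [set: X]) (mu_finite : (mu [set: X] < +oo)%E).
Context (mu_doubling : doubling mu) (p_ge1 : 1 <= p) (a_gt0 : 0 < a).
Context (rho : nat -> {finite_measure set (X * X)%type -> \bar R}).
Context (rho_kernel : local_kernel rho).
Context (rho_poincare : poincare mu rho p a).
Context (rho_cutoff : controlled_cutoff mu rho p a).
Implicit Types (x y : X) (r e : R) (f g : X -> R).
Local Open Scope ereal_scope.

Local Notation vol := (vol mu).
Local Notation osc := (osc mu p).

Let p_gt0 : (0 < p)%R. Proof. by rewrite (lt_le_trans ltr01). Qed.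
Let pa_gt0 : (0 < p * a)%R. Proof. by rewrite mulr_gt0. Qed.

Lemma energy_ge0 (b : R) f r : 0 <= energy mu p b f r.
Proof.
apply: integral_ge0 => x _; apply: mule_ge0;
  first by rewrite lee_fin invr_ge0 fine_ge0.
by apply: integral_ge0 => y _; rewrite lee_fin divr_ge0 ?powR_ge0.
Qed.

Lemma Lnorm_powR (g f : X -> R) :
  Lnorm mu p%:E (EFin \o (g \- f)%R) `^ p = \int[mu]_x (`|g x - f x| `^ p)%:E.
Proof. by rewrite poweR_Lnorm ?gt_eqF//; apply: eq_integral => x _. Qed.

Lemma cvg_LpP (f_ : nat -> X -> R) f : cvg_Lp mu p f_ f <->
  forall h : R, (0 < h)%R ->
    \forall m \near \oo, \int[mu]_x (`|f_ m x - f x| `^ p)%:E <= h%:E.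
Proof.
have mono (q : R) (x y : \bar R) : (0 < q)%R -> 0 <= x -> x <= y -> x `^ q <= y `^ q.
  move=> q0 x0 xy; apply: gt0_ler_poweR (xy);
    rewrite ?ltW// in_itv/= ?x0 leey// andbT.
  exact: le_trans xy.
split=> [cf h h0|H].
  have [_ cs] := cvg_limn_einf_sup cf.
  have hp : (0 < h `^ p^-1)%R by rewrite powR_gt0.
  have : limf_esup (fun m => Lnorm mu p%:E (EFin \o (f_ m \- f)%R)) \oo < (h `^
    p^-1)%:E.
    by rewrite [limf_esup _ _]cs lte_fin.
  move=> /limf_esup_lt; apply: filterS => m /= /ltW Lm; rewrite -Lnorm_powR.
  apply: (le_trans (mono _ _ _ p_gt0 (Lnorm_ge0 _ _ _) Lm)).
  by rewrite poweR_EFin -powRrM mulVf ?gt_eqF// powRr1// ltW.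
apply: limn_esup_le_cvg; last by move=> m; exact: Lnorm_ge0.
apply/lee_addgt0Pr => h h0; rewrite add0e.
have hp : (0 < h `^ p)%R by rewrite powR_gt0.
apply: limf_esup_ub; apply: filterS (H _ hp) => m; rewrite -Lnorm_powR => Lm.
have ip : (0 < p^-1)%R by rewrite invr_gt0.
have := mono _ _ _ ip (poweR_ge0 _ _) Lm.
rewrite -poweRrM mulfV ?gt_eqF// poweRe1 ?Lnorm_ge0// => /le_trans; apply.
by rewrite poweR_EFin -powRrM mulfV ?gt_eqF// powRr1// ltW.
Qed.

(** At a fixed radius the energy is continuous in the mean of order [p], up to
    a multiplicative constant that does not depend on the radius. *)
Lemma integral_osc_stable r : (0 < r)%R -> exists2 L : R, (0 < L)%R &
  forall f g, measurable_fun [set: X] f -> measurable_fun [set: X] g ->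
  \int[mu]_x osc f r x <= (3 `^ p)%:E * (\int[mu]_x osc g r x +
     L%:E * \int[mu]_x (`|g x - f x| `^ p)%:E).
Proof.
move=> r0; have [v v0 vP] := vol_lower_bound mu_finite mu_doubling X_compact r0.
pose V := fine (mu [set: X]).
have VE : mu [set: X] = V%:E by rewrite fineK// mu_fin_num.
have V0 : (0 <= V)%R by rewrite fine_ge0.
exists (v^-1 * V + 1)%R => [|f g mf mg].
  by rewrite ltr_wpDl// mulr_ge0// invr_ge0 ltW.
set D := \int[mu]_x (`|g x - f x| `^ p)%:E.
have D0 : 0 <= D by apply: integral_ge0 => x _; rewrite lee_fin powR_ge0.
have mD : measurable_fun [set: X] (fun x => (`|g x - f x| `^ p)%:E).
  apply/measurable_EFinP; apply: (measurableT_comp (measurable_powR p)).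
  by apply: measurableT_comp => //; exact: measurable_funB.
have mo : measurable_fun [set: X] (osc g r) by exact: measurable_osc.
have W0 : 0 <= v^-1%:E * D by rewrite mule_ge0// lee_fin invr_ge0 ltW.
have Dx0 x : 0 <= (`|g x - f x| `^ p)%:E by rewrite lee_fin powR_ge0.
have og0 x : 0 <= osc g r x by exact: osc_ge0.
have step x : osc f r x <= (3 `^ p)%:E * (osc g r x + (cst (v^-1%:E * D) x + (`|g x
  - f x| `^ p)%:E)).
  have mB : measurable (ball x r) by exact: measurable_metric_ball.
  have vx : (0 < vol x r)%R by rewrite vol_gt0.
  have mgB : measurable_fun (ball x r) (fun y => (`|g y - g x| `^ p)%:E).
    by apply: measurable_powR_norm; exact: measurable_funTS.
  have mDB : measurable_fun (ball x r) (fun x => (`|g x - f x| `^ p)%:E).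
    exact: measurable_funTS.
  have gx0 y : 0 <= (`|g y - g x| `^ p)%:E by rewrite lee_fin powR_ge0.
  have : \int[mu]_(y in ball x r) (`|f y - f x| `^ p)%:E <=
      (3 `^ p)%:E * (\int[mu]_(y in ball x r) (`|g y - g x| `^ p)%:E +
        (\int[mu]_(y in ball x r) (`|g y - f y| `^ p)%:E +
         \int[mu]_(y in ball x r) cst (`|g x - f x| `^ p)%:E y)).
    have cx0 (y : X) : 0 <= cst (`|g x - f x| `^ p)%:E y by exact: Dx0.
    rewrite -ge0_integralD//.
    rewrite -ge0_integralD//; last 2 first.
    - by move=> y _; rewrite adde_ge0.
    - by apply: emeasurable_funD => //; exact: measurable_cst.
    rewrite -ge0_integralZl//; last 2 first.
    - by apply: emeasurable_funD => //; apply: emeasurable_funD => //;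
      exact: measurable_cst.
    - by move=> y _; rewrite !adde_ge0.
    apply: ge0_integral_mono => y _; first by rewrite lee_fin powR_ge0.
    rewrite /cst -!EFinD -EFinM lee_fin.
    have := @powR_norm_sum_le R p p_gt0 R
      [:: g y - g x; - (g y - f y); g x - f x]%R predT id 3 isT.
    rewrite !big_cons !big_nil !addr0 /= normrN => /(le_trans _); apply.
    rewrite le_eqVlt; apply/orP; left; apply/eqP; congr (`|_| `^ p)%R; ring.
  rewrite integral_cst// => H.
  rewrite /osc; apply: le_trans (lee_wpmul2l _ H) _.
    by rewrite lee_fin invr_ge0 ltW.
  rewrite muleCA; apply: lee_wpmul2l; first by rewrite lee_fin powR_ge0.
  have vxi : 0 <= (vol x r)^-1%:E by rewrite lee_fin invr_ge0 ltW.
  have I0 (B : set X) : 0 <= \int[mu]_(y in B) (`|g y - f y| `^ p)%:E.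
    by apply: integral_ge0 => y _.
  rewrite volE// ge0_muleDr//; last 2 first.
  - exact: integral_ge0.
  - by rewrite adde_ge0// mule_ge0// lee_fin vol_ge0.
  apply: leeD => //; rewrite ge0_muleDr//; last first.
    by rewrite mule_ge0// lee_fin vol_ge0.
  apply: leeD.
    apply: lee_pmul => //; first by rewrite lee_fin lef_pV2 ?posrE.
    by apply: ge0_integral_subset.
  by rewrite -!EFinM lee_fin mulrCA mulVf ?mulr1// gt_eqF.
have c0 x : 0 <= cst (v^-1%:E * D) x by [].
apply: (@le_trans _ _ (\int[mu]_x ((3 `^ p)%:E *
    (osc g r x + (cst (v^-1%:E * D) x + (`|g x - f x| `^ p)%:E))))).
  by apply: ge0_integral_mono => x _; [exact: osc_ge0|exact: step].
have mc : measurable_fun [set: X] (fun x => cst (v^-1%:E * D) x + (`|g x - f x| `^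
  p)%:E).
  by apply: emeasurable_funD => //; exact: measurable_cst.
rewrite ge0_integralZl//; last 2 first.
- exact: emeasurable_funD.
- by move=> x _; rewrite !adde_ge0.
apply: lee_wpmul2l; first by rewrite lee_fin powR_ge0.
rewrite ge0_integralD//; last by move=> x _; rewrite adde_ge0.
apply: leeD => //; rewrite ge0_integralD//.
rewrite integral_cst// VE muleAC -EFinM -[X in _ + X]mul1e -ge0_muleDl ?lee_fin//.
by rewrite mulr_ge0// invr_ge0 ltW.
Qed.

Lemma regularization_exists : exists2 K : R, (0 < K)%R &
  forall f e, (0 < e)%R -> f \in Lfun mu p%:E -> exists g, [/\ Fp rho p g,
    \int[mu]_x (`|g x - f x| `^ p)%:E <= K%:E * \int[mu]_x osc f (6 * e) x &
    limn_einf (fun n => nu rho p n g [set: X]) <=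
      (K / e `^ (p * a))%:E * \int[mu]_x osc f (6 * e) x].
Proof.
have [C [N [C0 cut]]] := finite_cutoff X_compact rho_cutoff.
have [K1 K10 HK1] := average_center_le mu_finite mu_doubling p_ge1.
have [K2 K20 HK2] := average_pair_le X_compact mu_finite mu_doubling p_ge1.
pose A1 := (N%:R `^ p * (N%:R * K1) : R)%R.
pose A2 := (N%:R `^ p * (2 * C * (N%:R * (K2 * N%:R))) : R)%R.
have A10 : (0 <= A1)%R by rewrite !mulr_ge0 ?powR_ge0 ?(ltW K10).
have A20 : (0 <= A2)%R by rewrite !mulr_ge0 ?powR_ge0 ?(ltW K20) ?(ltW C0).
exists (A1 + A2 + 1)%R => [|f e e0 fL]; first by rewrite ltr_wpDl// addr_ge0.
have [I [s [c [phi [cov ov phiP sum1]]]]] := cut e e0.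
have O0 : 0 <= \int[mu]_x osc f (6 * e) x.
  by apply: integral_ge0 => x _; exact: osc_ge0.
have phiF i : Fp rho p (phi i) by case: (phiP i).
have phi01 i x : (0 <= phi i x <= 1)%R by case: (phiP i).
have phi0 i x : (2 * e <= mdist (c i) x)%R -> phi i x = 0%R by case: (phiP i) => _
  _ + _; exact.
have phinu i := let: And4 _ _ _ h := phiP i in h.
exists (regularized mu e s c phi f); split.
- exact: regularized_Fp.
- apply: le_trans (regularized_approx_le X_compact mu_finite p_ge1 e0
    ov phi01 phi0 sum1 fL K10 _) _ => //.
    by move=> x i cx; exact: HK1.
  by apply: lee_wpmul2r => //; rewrite lee_fin -/A1; lra.
- apply: le_trans (regularized_liminf_nu_le X_compact mu_finite mu_doubling
    p_ge1 rho_kernel e0 C0 cov ov phiF phi0 phinu sum1 fL K20 _) _ => //.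
    by move=> i j cij; exact: HK2.
  apply: lee_wpmul2r => //; rewrite lee_fin.
  have -> : (N%:R `^ p * (2 * C / e `^ (a * p) * (N%:R * (K2 * N%:R))) =
     A2 / e `^ (p * a))%R by rewrite /A2 (mulrC a p); ring.
  by rewrite ler_pM2r ?invr_gt0 ?powR_gt0//; lra.
Qed.

(** The Poincare inequality bounds the energy of the approximants, and the
    bound passes to their limit because the radius stays fixed. *)
Lemma energy_le_relaxed : exists2 K : R, (0 < K)%R & forall f r, (0 < r)%R ->
  f \in Lfun mu p%:E -> energy mu p a f r <= K%:E * relaxed_energy mu rho p f.
Proof.
have [K K0 HK] := integral_osc_le_liminf_nu X_compact mu_finite mu_doubling
  p_ge1 rho_poincare rho_cutoff.
have K3 : (0 < 3 `^ p * K)%R by rewrite mulr_gt0// powR_gt0.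
exists (3 `^ p * K)%R => // f r r0 fL; have mf := Lfun_measurable fL.
rewrite -lee_pdivrMl//; apply: le_ereal_inf_tmp => _ [f_ [Ff cf] <-].
rewrite lee_pdivrMl// energyE//.
have rpa : (0 < r `^ (p * a))%R by rewrite powR_gt0.
rewrite lee_pdivrMl// muleA -EFinM.
set B := (r `^ (p * a) * _)%R.
have B0 : (0 < B)%R by rewrite mulr_gt0.
have [L L0 HL] := integral_osc_stable r0.
have v0 m : 0 <= limn_einf (fun n => nu rho p n (f_ m) [set: X]).
  by rewrite limn_einf_filter; apply: limf_einf_ge0 => n; exact: nu_ge0.
apply/lee_addgt0Pr => h h0; rewrite -leeBlDr//.
rewrite limn_einf_filter; apply: le_trans (limf_einfZ_le _ B0 v0).
apply: limf_einf_ge.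
have hL : (0 < h / (3 `^ p * L))%R by rewrite divr_gt0// mulr_gt0// powR_gt0.
have := (cvg_LpP f_ f).1 cf _ hL; apply: filterS => m Dm /=.
have mg : measurable_fun [set: X] (f_ m) by exact: continuous_measurable (Ff m).1.
rewrite EFinN leeBlDr//; apply: le_trans (HL f (f_ m) mf mg) _.
rewrite ge0_muleDr//; last 2 first.
- by apply: integral_ge0 => x _; exact: osc_ge0.
- rewrite mule_ge0 ?lee_fin ?(ltW L0)//.
  by apply: integral_ge0 => x _; rewrite lee_fin powR_ge0.
apply: leeD.
  apply: (@le_trans _ _ ((3 `^ p)%:E * ((K * r `^ (p * a))%:E *
      limn_einf (fun n => nu rho p n (f_ m) [set: X])))).
    by apply: lee_wpmul2l; [rewrite lee_fin powR_ge0|exact: HK].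
  rewrite muleA -EFinM (_ : 3 `^ p * (K * r `^ (p * a)) = B)%R//.
  by rewrite /B; ring.
apply: (@le_trans _ _ ((3 `^ p)%:E * (L%:E * (h / (3 `^ p * L))%:E))).
  apply: lee_wpmul2l; first by rewrite lee_fin powR_ge0.
  by apply: lee_wpmul2l; first by rewrite lee_fin ltW.
rewrite -!EFinM lee_fin le_eqVlt; apply/orP; left; apply/eqP.
by field; rewrite !gt_eqF// powR_gt0.
Qed.

Lemma liminf_energy_fin f : korevaar_schoen mu p a f ->
  exists2 l : R, (0 <= l)%R & limf_einf (energy mu p a f) 0^'+ = l%:E.
Proof.
move=> [_ fKS]; have L0 : 0 <= limf_einf (energy mu p a f) 0^'+.
  by apply: limf_einf_ge0 => r; exact: energy_ge0.
have Lfin : limf_einf (energy mu p a f) 0^'+ \is a fin_num.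
  rewrite ge0_fin_numE//; apply: le_lt_trans fKS.
  exact: limf_einf_sup_le.
by exists (fine (limf_einf (energy mu p a f) 0^'+)); rewrite ?fine_ge0 ?fineK.
Qed.

(** Regularizing at scales along which the energy approaches its lower limit
    provides a competitor for the relaxed energy. *)
Lemma relaxed_le_liminf_energy : exists2 K : R, (0 < K)%R &
  forall f, korevaar_schoen mu p a f ->
  relaxed_energy mu rho p f <= K%:E * limf_einf (energy mu p a f) 0^'+.
Proof.
have [K K0 HK] := regularization_exists.
pose K' := (K * 6 `^ (p * a))%R.
have K'0 : (0 < K')%R by rewrite mulr_gt0// powR_gt0.
exists K' => // f fKS.
have [l l0 lE] := liminf_energy_fin fKS; have [fL _] := fKS.
have mf := Lfun_measurable fL.
have ex m : {g : X -> R | [/\ Fp rho p g,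
    \int[mu]_x (`|g x - f x| `^ p)%:E <= (m.+1%:R^-1)%R%:E &
    limn_einf (fun n => nu rho p n g [set: X]) <= (K' * (l + m.+1%:R^-1))%R%:E]}.
  apply: cid; set h : R := (m.+1%:R^-1)%R.
  have h0 : (0 < h)%R by rewrite invr_gt0.
  have kl : (0 <= K * (l + h))%R by rewrite mulr_ge0 ?addr_ge0 ?(ltW K0) ?(ltW h0).
  (* The radius is so small that the distance to [f] is at most [h]. *)
  have [b b0 Hb] := powR_small pa_gt0 kl h0.
  have near_b : \forall r \near 0^'+, (0 < r < b)%R.
    near=> r; apply/andP; split; near: r;
      [exact: nbhs_right_gt|exact: nbhs_right_lt].
  have Llt : limf_einf (energy mu p a f) 0^'+ < (l + h)%:E by rewrite lE lte_fin
    ltrDl.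
  have [r /= /andP[r0 rb] Er] := limf_einf_lt Llt near_b.
  have e0 : (0 < r / 6)%R by rewrite divr_gt0.
  have [g [Fg Dg Ng]] := HK f _ e0 fL.
  have r6 : (6 * (r / 6) = r)%R by field.
  have Or : \int[mu]_x osc f r x <= (r `^ (p * a) * (l + h))%:E.
    rewrite (@integral_oscE _ _ _ mu p X_compact mu_finite a)// EFinM;
      apply: lee_wpmul2l.
      by rewrite lee_fin powR_ge0.
    exact: ltW.
  exists g; split => //.
    rewrite r6 in Dg; apply: le_trans Dg _.
    apply: (@le_trans _ _ (K%:E * (r `^ (p * a) * (l + h))%:E)).
      by apply: lee_wpmul2l; first by rewrite lee_fin ltW.
    by rewrite -EFinM lee_fin mulrCA; exact: Hb.
  rewrite r6 in Ng; apply: le_trans Ng _.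
  apply: (@le_trans _ _ ((K / (r / 6) `^ (p * a))%:E * (r `^ (p * a) * (l + h))%:E)).
    apply: lee_wpmul2l => //; by rewrite lee_fin divr_ge0 ?powR_ge0 ?(ltW K0).
  have re : (r `^ (p * a) = 6 `^ (p * a) * (r / 6) `^ (p * a))%R.
    by rewrite -powRM ?(ltW e0)// r6.
  rewrite -EFinM lee_fin re /K'.
  have /lt0r_neq0 := powR_gt0 (p * a) e0; move: (powR (r / 6) _) => t t0.
  by rewrite le_eqVlt; apply/orP; left; apply/eqP; field.
pose g m := projT1 (ex m).
apply: (@le_trans _ _ (limn_einf (fun m => limn_einf (fun n => nu rho p n (g m)
  [set: X])))).
  apply: ereal_inf_lbound; exists g => //; split => [m|].
    by have [] := projT2 (ex m).
  apply/cvg_LpP => h h0; near=> m.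
  have [_ Dm _] := projT2 (ex m); apply: (le_trans Dm); rewrite lee_fin ltW//.
  by near: m; exact: near_infty_natSinv_lt (PosNum h0).
rewrite lE; apply/lee_addgt0Pr => h h0.
have hK : (0 < h / K')%R by rewrite divr_gt0.
rewrite limn_einf_filter; apply: limf_einf_ub; near=> m.
have [_ _ Nm] := projT2 (ex m); apply: (le_trans Nm).
rewrite -EFinM -EFinD lee_fin mulrDr lerD2l mulrC -ler_pdivlMr// ltW//.
by near: m; exact: near_infty_natSinv_lt (PosNum hK).
Unshelve. all: by end_near. Qed.

End relaxation.

(** * The critical exponent and the comparison *)

Section critical.
Context (d : measure_display) (R : realType) (X : borelMetricType d R).
Context (mu : {measure set X -> \bar R}) (p a : R).
Context (X_compact : compact [set: X]) (mu_finite : (mu [set: X] < +oo)%E).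
Context (mu_doubling : doubling mu) (p_ge1 : 1 <= p) (a_gt0 : 0 < a).
Implicit Types (x y : X) (r e b : R) (f g : X -> R).
Local Open Scope ereal_scope.

Local Notation vol := (vol mu).
Local Notation osc := (osc mu p).

Let p_gt0 : (0 < p)%R. Proof. by rewrite (lt_le_trans ltr01). Qed.

(** A value that differs from the constant persists on a ball, which has
    positive measure. *)
Lemma continuous_nonconstant f x y : continuous f -> f x <> f y -> nonconstant mu f.
Proof.
move=> cf fxy [k fk].
have [z fz] : exists z, f z <> k.
  have [fx|fx] := pselect (f x = k); last by exists x.
  by exists y => fy; apply: fxy; rewrite fx fy.
have oU : open (f @^-1` [set t | t != k]).
  move/continuousP : cf; apply.
  exact: open_neq.
have : nbhs z (f @^-1` [set t | t != k]).
  by apply: open_nbhs_nbhs; split => //=; exact/eqP.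
move=> /nbhs_ballP[r /= r0 rU].
have := vol_gt0 mu_finite mu_doubling z r0; rewrite -lte_fin -volE//.
case: fk => A [mA A0 fA]; apply/negP; rewrite -leNgt.
apply: (@le_trans _ _ (mu A)); last by rewrite A0.
apply: le_measure; rewrite ?inE//; first exact: measurable_metric_ball.
by move=> w /rU /= fw; apply: fA => /= fwk; rewrite fwk eqxx in fw.
Qed.

(** At a radius beyond the diameter the energy compares [f] with its average
    over the whole space. *)
Lemma energy_eq0_constant f : f \in Lfun mu p%:E ->
  (forall r, (0 < r)%R -> energy mu p a f r = 0) -> ~ nonconstant mu f.
Proof.
move=> fL f0; apply; have mf := Lfun_measurable fL.
have [D D0 XD] := finite_diameter X_compact.
have DT x : ball x D = [set: X].
  by apply/seteqP; split => // y _; rewrite mem_ball.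
have [[z _]|nX] := pselect (exists x : X, True); last first.
  by exists 0%R; apply: aeW => x; case: nX; exists x.
pose m := average mu f (ball z D); exists m.
have mfm : measurable_fun [set: X] (fun x => (`|f x - m| `^ p)%:E).
  exact: measurable_powR_norm.
have : \int[mu]_x (`|f x - m| `^ p)%:E <= \int[mu]_x osc f D x.
  apply: ge0_integral_mono => x _; first by rewrite lee_fin powR_ge0.
  have := average_powR_le mu_finite mu_doubling p_ge1 (f x) z D0 fL.
  rewrite -/m volE// -lee_pdivlMr ?vol_gt0// => /le_trans; rewrite distrC; apply.
  have -> : vol z D = vol x D by apply: (congr1 (fun A => fine (mu A))); rewrite !DT.
  by rewrite muleC /osc !DT.
rewrite (@integral_oscE _ _ _ mu p X_compact mu_finite a)// f0// mule0 => I0.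
have {}I0 : \int[mu]_x `|(`|f x - m| `^ p)%:E| = 0.
  apply/eqP; rewrite eq_le integral_ge0// andbT.
  by under eq_integral do rewrite gee0_abs ?lee_fin ?powR_ge0//.
have /ae_eq_integral_abs := mfm => /(_ mu measurableT).
move=> [/(_ I0) + _]; apply: filterS => x /(_ Logic.I) [] /powR_eq0_eq0.
by move=> /eqP; rewrite normr_eq0 subr_eq0 => /eqP.
Qed.

(** The energy of exponent [a] is [r `^ (p * (b - a))] times the one of
    exponent [b], hence tends to [0]; [property_P] then makes it vanish at all
    radii. *)
Lemma besov_gt_trivial b f : property_P mu p a -> (a < b)%R ->
  besov mu p b f -> ~ nonconstant mu f.
Proof.
move=> [_ [C C1 HP]] ab [fL supf]; have mf := Lfun_measurable fL.
have q0 : (0 < p * (b - a))%R by rewrite mulr_gt0// subr_gt0.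
have sup0 : 0 <= sup_energy mu p b f.
  apply: le_trans (ereal_sup_ubound _); last by exists 1%R => //=; reflexivity.
  exact: energy_ge0.
have Efin : sup_energy mu p b f \is a fin_num by rewrite ge0_fin_numE.
pose S := fine (sup_energy mu p b f).
have S0 : (0 <= S)%R by rewrite fine_ge0.
have Er r : (0 < r)%R -> energy mu p a f r <= (r `^ (p * (b - a)) * S)%:E.
  move=> r0; rewrite energyE//.
  rewrite (@integral_oscE _ _ _ mu p X_compact mu_finite b)// muleA -EFinM [in
    leRHS]EFinM.
  have -> : ((r `^ (p * a))^-1 * r `^ (p * b) = r `^ (p * (b - a)))%R.
    rewrite -powRN -powRD; last by rewrite (gt_eqF r0) implybT.
    congr (powR _ _); ring.
  apply: lee_wpmul2l; first by rewrite lee_fin powR_ge0.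
  by rewrite fineK//; apply: ereal_sup_ubound; exists r.
have small h : (0 < h)%R -> \forall r \near 0^'+, energy mu p a f r <= h%:E.
  move=> h0; have [c c0 Hc] := powR_small q0 S0 h0.
  apply: filterS2 (nbhs_right_gt 0%R) (nbhs_right_lt c0) => r r0 rc.
  by apply: (le_trans (Er r r0)); rewrite lee_fin; exact: Hc.
have fKS : korevaar_schoen mu p a f.
  split => //; apply: (@le_lt_trans _ _ 1%:E); last exact: ltry.
  by apply: limf_esup_ub; exact: small.
have L0 : limf_einf (energy mu p a f) 0^'+ <= 0.
  apply/lee_addgt0Pr => h h0; rewrite add0e.
  by apply: limf_einf_ub; exact: small.
have sup_a0 : sup_energy mu p a f <= 0.
  apply: (le_trans (HP f fKS)); rewrite -(mule0 C%:E).
  by apply: lee_wpmul2l => //; rewrite lee_fin (le_trans ler01).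
apply: energy_eq0_constant => // r r0; apply/eqP.
rewrite eq_le energy_ge0 andbT; apply: le_trans sup_a0.
by apply: ereal_sup_ubound; exists r.
Qed.

Lemma property_P_critical : property_P mu p a -> critical_exponent mu p = a%:E.
Proof.
move=> P; apply/eqP; rewrite eq_le; apply/andP; split.
  apply: ge_ereal_sup => _ [b [b0 [f fb nf]] <-]; rewrite lee_fin leNgt.
  by apply/negP => ab; exact: (besov_gt_trivial P ab fb nf).
apply: ereal_sup_ubound; exists a => //; split; first exact: ltW.
have [[f fKS nf] [C C1 HP]] := P; exists f => //; split; first exact: fKS.1.
apply: (le_lt_trans (HP f fKS)).
have [l l0 ->] := liminf_energy_fin fKS.
by rewrite -EFinM ltry.
Qed.

End critical.

Theorem theorem5p2 (d : measure_display) (R : realType)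
    (X : borelMetricType d R) (mu : {measure set X -> \bar R})
    (p a : R) (rho : nat -> {finite_measure set (X * X)%type -> \bar R})
    (X_compact : compact [set: X]) (X_nontrivial : exists x y : X, x <> y)
    (mu_radon : radon mu measurable) (mu_doubling : doubling mu)
    (p_ge1 : 1 <= p) (a_gt0 : 0 < a)
    (rho_kernel : local_kernel rho)
    (rho_poincare : poincare mu rho p a)
    (rho_cutoff : controlled_cutoff mu rho p a) :
  property_P mu p a /\
  exists C1 C2 : R, [/\ 0 < C1, 0 < C2 &
    forall f, korevaar_schoen mu p a f ->
      (C1%:E * Var mu p f `^ p <= relaxed_energy mu rho p f)%E /\
      (relaxed_energy mu rho p f <= C2%:E * Var mu p f `^ p)%E].
Proof.
have p_gt0 : 0 < p by rewrite (lt_le_trans ltr01).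
have mu_finite : (mu [set: X] < +oo)%E := mu_radon.1 _ X_compact.
have [K1 K10 HK1] := energy_le_relaxed X_compact mu_finite mu_doubling p_ge1
  rho_poincare rho_cutoff.
have [K2 K20 HK2] := relaxed_le_liminf_energy X_compact mu_finite mu_doubling
  p_ge1 a_gt0 rho_kernel rho_cutoff.
have [K0 K00 HK0] := integral_osc_le_liminf_nu X_compact mu_finite mu_doubling
  p_ge1 rho_poincare rho_cutoff.
have Fp_KS f : Fp rho p f -> korevaar_schoen mu p a f.
  move=> Ff; have fL := Fp_Lfun X_compact mu_finite p_ge1 Ff; split => //.
  have mf := Lfun_measurable fL; have [_ nuf] := Ff.
  set S := ereal_sup _ in nuf.
  apply: (@le_lt_trans _ _ (K0%:E * S)%E); last first.
    by apply: lte_mul_pinfty; rewrite ?lee_fin// ltW.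
  apply: limf_esup_ub; near=> r.
  have r0 : 0 < r by near: r; exact: nbhs_right_gt.
  have rpa : 0 < r `^ (p * a) by rewrite powR_gt0.
  rewrite energyE// lee_pdivrMl// muleA -EFinM mulrC.
  apply: (le_trans (HK0 f r Ff r0)); apply: lee_wpmul2l.
    by rewrite lee_fin mulr_ge0 ?ltW.
  rewrite limn_einf_filter; apply: limf_einf_ub; apply: nearW => n.
  by apply: ereal_sup_ubound; exists n.
have P : property_P mu p a.
  split.
    have [x [y xy]] := X_nontrivial.
    have xy0 : 0 < mdist x y by rewrite mdist_gt0; exact/eqP.
    have [C [N [_ cut]]] := finite_cutoff X_compact rho_cutoff.
    (* At this scale no support of a cutoff function contains [x] and [y]. *)
    have e0 : 0 < mdist x y / 4 by rewrite divr_gt0.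
    have [I [s [c [phi [_ _ phiP sum1]]]]] := cut _ e0.
    have [i phix] : exists i, phi i x <> 0.
      apply: contrapT => /forallNP phi0; have := sum1 x.
      rewrite big1 => [/esym/eqP|i _]; first by rewrite oner_eq0.
      exact: contrapT (phi0 i).
    have [Fi _ phi0 _] := phiP i; exists (phi i); first exact: Fp_KS.
    apply: (@continuous_nonconstant _ _ _ mu mu_finite mu_doubling _ x y Fi.1).
    rewrite (phi0 y)// leNgt; apply/negP => ciy.
    apply: phix; apply: phi0; rewrite leNgt; apply/negP => cix.
    by have := metric_triangle x (c i) y; rewrite (metric_sym x (c i)); lra.
  (* The summand [1] only serves to make the constant at least [1]. *)
  exists (K1 * K2 + 1) => [|f fKS]; first by rewrite lerDr mulr_ge0 ?ltW.
  have [l l0 lE] := liminf_energy_fin fKS.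
  apply: ge_ereal_sup => _ [r /= r0 <-].
  apply: (le_trans (HK1 f r r0 fKS.1)).
  apply: (@le_trans _ _ (K1%:E * (K2%:E * limf_einf (energy mu p a f) 0^'+))%E).
    by apply: lee_wpmul2l; [rewrite lee_fin ltW|exact: HK2].
  rewrite lE -!EFinM lee_fin mulrA; apply: ler_wpM2r => //.
  by rewrite lerDl.
split => //; exists K1^-1, K2; split => //; first by rewrite invr_gt0.
move=> f fKS.
have -> : (Var mu p f `^ p = limf_einf (energy mu p a f) 0^'+)%E.
  rewrite /Var (property_P_critical X_compact mu_finite mu_doubling p_ge1 a_gt0 P)
    /=.
  by apply: limf_einf_poweR => // r; exact: energy_ge0.
split; last exact: HK2.
rewrite lee_pdivrMl//; apply: limf_einf_ub; near=> r.
by apply: HK1; [near: r; exact: nbhs_right_gt|exact: fKS.1].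
Unshelve. all: by end_near. Qed.
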